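(* Let $\beta$ be a quasi-Pisot or quasi-Salem number and $\xi$ an algebraic number with $D=[\mathbb{Q}(\beta,\xi):\mathbb{Q}(\beta)]$. Let $S$ be a finite subset of $\mathbb{Z}[\beta]$ with $0\in S$. Moreover, if $S\not\subset \mathbb{Z}$, then suppose that $\beta\notin\mathbb{R}$ and there exists an imaginary quadratic algebraic integer $\alpha\in \mathbb{Q}(\beta)$ such that $S$ is a finite subset of the ring of integers of $\mathbb{Q}(\alpha)$. Let $R\geq 0$ be an integer and let $\mathbf{t}=(t_n)_{n\ge 1-R}$ be a sequence of elements of $S$ satisfying $\xi=\sum_{n=1-R}^{\infty}t_n\beta^{-n}$. Assume there exist $\pi,A_0,A_1,\ldots,A_D\in \mathbb{Z}[\beta]$ with $\pi\neq 0$, $A_D\neq 0$ satisfying the following: (i) $A_D \xi^D+A_{D-1} \xi^{D-1}+\cdots+A_0=0$; (ii) $\dfrac{(\beta-1)^{D-k}A_k}{\pi} \in \mathbb{Z}[\beta]$ for $1 \le k \le D$; (iii) $\dfrac{(\beta-1)^{D}\beta^n A_0}{\pi} \notin \mathbb{Z}[\beta]$ for all $n\in \mathbb{N}$. Then there exist effectively computable positive numbers $C_5$ and $C_6$ such that $$\gamma(\mathbf{t};N):=\mathrm{Card}\{n\in \mathbb{N}\mid n\le N,\ t_n\neq t_{n+1}\}\ge C_5\left(\frac{N}{\log N}\right)^{1/D}$$ for all integers $N\ge C_6$.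
   Context: $\mathbb{N}$ denotes the set of positive integers, and $\mathrm{Card}$ denotes cardinality. Algebraic numbers are regarded as complex numbers via a fixed embedding $\overline{\mathbb{Q}}\hookrightarrow\mathbb{C}$. Quasi-Pisot and quasi-Salem numbers: let $\beta$ be an algebraic integer with $|\beta|>1$, and let $\beta_1=\beta,\beta_2,\ldots,\beta_d$ ($d=[\mathbb{Q}(\beta):\mathbb{Q}]$) be its conjugates over $\mathbb{Q}$. $\beta$ is a quasi-Pisot number if $|\beta_i|<1$ for every $\beta_i\notin\{\beta,\overline{\beta}\}$, where $\overline{\beta}$ is the complex conjugate of $\beta$. $\beta$ is a quasi-Salem number if $|\beta_i|\le 1$ for every $\beta_i\notin\{\beta,\overline{\beta}\}$ and there exists $1\le j\le d$ with $|\beta_j|=1$. *)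

(* Defs.v *)
From HB Require Import structures.
From mathcomp Require Import all_boot all_order all_algebra all_field.
From mathcomp Require Import all_classical all_reals all_analysis.
From mathcomp Require Import ring.

Set Implicit Arguments.
Unset Strict Implicit.
Unset Printing Implicit Defensive.

Import Order.TTheory GRing.Theory Num.Theory.
Import numFieldNormedType.Exports.

Local Open Scope classical_set_scope.
Local Open Scope ring_scope.

Definition zeval (p : {poly int}) (z : algC) : algC := (map_poly intr p).[z].

Definition qeval (p : {poly rat}) (z : algC) : algC := (map_poly ratr p).[z].

Definition in_Zadj (beta x : algC) : Prop :=
  exists p : {poly int}, x = zeval p beta.

Definition in_Qadj (beta x : algC) : Prop :=
  exists p q : {poly rat}, qeval q beta != 0 /\ x = qeval p beta / qeval q beta.

Definition conjugates_over_Q (beta b : algC) : bool := root (minCpoly beta) b.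

Definition quasi_Pisot (beta : algC) : Prop :=
  [/\ beta \in Aint, 1 < `|beta|
    & forall b, conjugates_over_Q beta b -> b != beta -> b != beta^* ->
        `|b| < 1].

Definition quasi_Salem (beta : algC) : Prop :=
  [/\ beta \in Aint, 1 < `|beta|,
      forall b, conjugates_over_Q beta b -> b != beta -> b != beta^* ->
        `|b| <= 1
    & exists2 b, conjugates_over_Q beta b & `|b| = 1].

(* [Q(beta, xi) : Q(beta)] = D.  Degrees of field extensions are available for
   subfields of a finite extension L of Q, so the degree is computed in any
   number field L, embedded in algC, that contains beta and xi. *)
Definition relative_degree (beta xi : algC) (D : nat) : Prop :=
  exists (L : fieldExtType rat) (iota : {rmorphism L -> algC}) (b x : L),
    [/\ iota b = beta, iota x = xi
      & \dim_<<1; b>> <<<<1; b>>; x>> = D].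

Definition imaginary_quadratic_integer (alpha : algC) : Prop :=
  [/\ alpha \in Aint, size (minCpoly alpha) = 3%N & alpha \notin Num.real].

Definition in_ring_of_integers (alpha x : algC) : Prop :=
  in_Qadj alpha x /\ x \in Aint.

(* algC carries its topology only through its numFieldType structure, whence
   the abstract field K. *)
Definition series_converges_to (K : numFieldType) (u : nat -> K) (l : K) :
  Prop := series u @ \oo --> l.

(* xi = sum_{n >= 1 - r} t_n beta^(-n); the values of t below 1 - r are
   irrelevant. *)
Definition is_expansion (beta xi : algC) (r : nat) (t : int -> algC) : Prop :=
  series_converges_to
    (fun k : nat => let n : int := 1 - r%:Z + k%:Z in t n * beta ^ (- n)) xi.

Definition num_changes (t : int -> algC) (N : nat) : nat :=
  (\sum_(1 <= n < N.+1) (t n%:Z != t n.+1%:Z))%N.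

(* The total recursive functions: the least class containing zero, successor
   and projections, and closed under composition, primitive recursion and
   minimization of regular functions.  The last three clauses characterize the
   new function h by its values, so the class is closed under extensional
   equality. *)
Inductive recursive : forall k : nat, (k.-tuple nat -> nat) -> Prop :=
| rec_zero k : @recursive k (fun=> 0%N)
| rec_succ : @recursive 1 (fun v => (thead v).+1)
| rec_proj k (i : 'I_k) : @recursive k (fun v => tnth v i)
| rec_comp k m (f : m.-tuple nat -> nat) (g : 'I_m -> k.-tuple nat -> nat)
    (h : k.-tuple nat -> nat) :
    recursive f -> (forall i, recursive (g i)) ->
    (forall v : k.-tuple nat, h v = f [tuple g i v | i < m]) ->
    recursive h
| rec_prim k (f : k.-tuple nat -> nat) (g : k.+2.-tuple nat -> nat)
    (h : k.+1.-tuple nat -> nat) :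
    recursive f -> recursive g ->
    (forall v : k.-tuple nat, h [tuple of 0%N :: v] = f v) ->
    (forall (n : nat) (v : k.-tuple nat), h [tuple of n.+1 :: v] =
       g [tuple of n :: h [tuple of n :: v] :: v]) ->
    recursive h
| rec_min k (f : k.+1.-tuple nat -> nat) (h : k.-tuple nat -> nat) :
    recursive f ->
    (forall v : k.-tuple nat, f [tuple of h v :: v] = 0%N /\
       forall y, (y < h v)%N -> f [tuple of y :: v] != 0%N) ->
    recursive h.

(* C x is a nonnegative real number that can be computed, uniformly in the
   finite datum x, to any precision: some recursive function maps (the code
   of) x and k to the numerator of a dyadic approximation of C x to within
   2^-k. *)
Definition effectively_computable (R : realType) (T : countType) (C : T -> R) :
  Prop :=
  exists2 f : 2.-tuple nat -> nat, recursive f &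
    forall (x : T) (k : nat),
      `|C x - (f [tuple pickle x; k])%:R / 2 ^+ k| <= (2 ^+ k)^-1.

(* Finite description of an algebraic number: an annihilating integer
   polynomial, together with the centre a + ib and the radius of a rational
   disc isolating the number among the roots of the polynomial. *)
Definition alg_code : countType := ({poly int} * (rat * rat) * rat)%type.

Definition describes (c : alg_code) (x : algC) : Prop :=
  let: (p, (a, b), e) := c in
  let near z := `|z - (ratr a + 'i * ratr b)| < ratr e in
  [/\ p != 0, zeval p x = 0, near x
    & forall y, zeval p y = 0 -> near y -> y = x].

(* Finite description of the data (beta, xi, S, r, pi, (A_0, ..., A_D)) on
   which the constants depend; elements of Z[beta] are given by integer
   polynomials in beta. *)
Definition data_code : countType :=
  (alg_code * alg_code * seq {poly int} * nat * {poly int} *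
   seq {poly int})%type.

Definition describes_data (c : data_code) (beta xi : algC) (S : seq algC)
    (r : nat) (pi : algC) (D : nat) (A : nat -> algC) : Prop :=
  let: (cbeta, cxi, cS, cr, cpi, cA) := c in
  [/\ describes cbeta beta, describes cxi xi,
      S =i [seq zeval s beta | s <- cS],
      cr = r
    & pi = zeval cpi beta /\
      mkseq A D.+1 = [seq zeval a beta | a <- cA]].

Lemma small_rat (e : algC) : 0 < e -> exists2 n : nat, (0 < n)%N & n%:R^-1 < e.
Proof.
move=> e0; have e1 : e^-1 \is Num.real by rewrite gtr0_real ?invr_gt0.
exists (Num.truncn e^-1).+1 => //.
rewrite -[ltRHS]invrK ltf_pV2 ?posrE ?invr_gt0 ?ltr0n //.
by rewrite real_truncnS_gt.
Qed.

Lemma rat_approx (x : algC) (n : nat) : (0 < n)%N -> x \is Num.real ->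
  exists a : rat, `|x - ratr a| <= n%:R^-1.
Proof.
move=> n0 xr; have nr : (n%:R : algC) \is Num.real by rewrite realn.
have n0' : (0 : algC) < n%:R by rewrite ltr0n.
have /andP[h1 h2] := real_floor_itv (realM nr xr).
exists ((Num.floor (n%:R * x))%:~R / n%:R).
rewrite fmorph_div /= ratr_int ratr_nat.
set f := Num.floor _ in h1 h2 *.
have -> : x - f%:~R / n%:R = (n%:R * x - f%:~R) / n%:R :> algC.
  by rewrite mulrBl mulrAC divff ?mul1r // gt_eqF.
rewrite normrM ger0_norm ?subr_ge0 // ger0_norm ?invr_ge0 ?ler0n //.
rewrite ler_pdivrMr // mulVf ?gt_eqF // lerBlDl.
by rewrite rmorphD /= in h2; exact: ltW.
Qed.

Lemma describes_ex (x : algC) : exists c : alg_code, describes c x.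
Proof.
have [p [Dp p_mon] _] := minCpolyP x.
have [q [a a0 Dq]] := rat_poly_scale p.
have qE : map_poly intr q = a%:~R *: minCpoly x :> {poly algC}.
  rewrite Dp Dq map_polyZ /= fmorphV /= ratr_int scalerA mulfV ?intr_eq0 // scale1r.
  rewrite -map_poly_comp; apply: eq_map_poly => z /=; by rewrite ratr_int.
have q0 : q != 0.
  apply: contra_neq (monic_neq0 p_mon) => q0.
  by rewrite Dq q0 rmorph0 scaler0.
have xq : zeval q x = 0.
  by rewrite /zeval qE hornerZ (rootP (root_minCpoly x)) mulr0.
have qC0 : map_poly intr q != 0 :> {poly algC}.
  by rewrite qE scaler_eq0 intr_eq0 negb_or a0 minCpoly_eq0.
have [rs Drs] := closed_field_poly_normal (map_poly intr q : {poly algC}).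
have rsP y : zeval q y = 0 -> y \in rs.
  move/rootP; rewrite -/(root _ _) Drs rootZ ?lead_coef_eq0 //.
  by rewrite root_prod_XsubC.
have [n n0 nP] : exists2 n : nat, (0 < n)%N &
   {in rs, forall y, y != x -> n%:R^-1 < `|y - x|}.
  elim: (rs) => [|z s [n n0 IH]]; first by exists 1%N.
  have [->|zx] := eqVneq z x.
    by exists n => // y; rewrite inE => /orP[/eqP->|/IH//]; rewrite eqxx.
  have [m m0 mP] : exists2 n : nat, (0 < n)%N & n%:R^-1 < `|z - x|.
    by apply: small_rat; rewrite normr_gt0 subr_eq0.
  exists (maxn n m); first by rewrite leq_max n0.
  have h (k : nat) : (0 < k)%N -> (k <= maxn n m)%N ->
     ((maxn n m)%:R^-1 : algC) <= k%:R^-1.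
    by move=> k0 km; rewrite lef_pV2 ?posrE ?ltr0n ?ler_nat // leq_max n0.
  move=> y; rewrite inE => /orP[/eqP-> _|ys yx].
    by apply: le_lt_trans mP; rewrite h ?leq_maxr.
  by apply: le_lt_trans (IH y ys yx); rewrite h ?leq_maxl.
have N0 : (0 < 5 * n)%N by rewrite muln_gt0.
have [ra ha] := rat_approx N0 (Creal_Re x).
have [rb hb] := rat_approx N0 (Creal_Im x).
pose eps : algC := (5 * n)%:R^-1.
have eps0 : 0 < eps by rewrite invr_gt0 ltr0n.
have hx : `|x - (ratr ra + 'i * ratr rb)| <= 2 * eps.
  rewrite {1}[x]Crect.
  have -> : 'Re x + 'i * 'Im x - (ratr ra + 'i * ratr rb)
     = ('Re x - ratr ra) + 'i * ('Im x - ratr rb) by ring.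
  rewrite (le_trans (ler_normD _ _)) // normrM normCi mul1r.
  by rewrite -[2]/(1 + 1) mulrDl mul1r lerD.
exists (q, (ra, rb), (2^-1 / n%:R)); split=> //.
  apply: le_lt_trans hx _.
  rewrite fmorph_div fmorphV /= !ratr_nat /eps natrM invfM mulrA.
  rewrite ltr_pM2r ?invr_gt0 ?ltr0n // ltr_pdivrMr ?ltr0n // mulrC.
  by rewrite ltr_pdivlMr ?ltr0n // -natrM ltr_nat.
move=> y /rsP yrs yn; apply/eqP; apply: contraT => yx.
have /lt_geF/negbT/negP[] := nP y yrs yx.
set c := ratr ra + _ in yn hx.
have -> : y - x = (y - c) - (x - c) by ring.
apply: le_trans (ler_normB _ _) _.
apply: le_trans (lerD (ltW yn) hx) _.
rewrite fmorph_div fmorphV /= !ratr_nat /eps natrM invfM mulrA -mulrDl.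
rewrite -[leRHS]mul1r ler_pM2r ?invr_gt0 ?ltr0n //.
have -> : (2^-1 + 2 / 5 : algC) = 9 / 10 by field; rewrite ?pnatr_eq0.
by rewrite ler_pdivrMr ?ltr0n // mul1r ler_nat.
Qed.

Lemma in_Zadj_seq (beta : algC) (xs : seq algC) :
  (forall x, x \in xs -> in_Zadj beta x) ->
  exists ps : seq {poly int}, xs = [seq zeval p beta | p <- ps].
Proof.
elim: xs => [|x xs IH] xsP; first by exists [::].
have [ps ->] := IH (fun y ys => xsP y (mem_behead (s := x :: xs) ys)).
by have [p ->] := xsP x (mem_head _ _); exists (p :: ps).
Qed.

Lemma describes_data_ex (beta xi : algC) (S : seq algC) (r : nat) (pi : algC)
    (D : nat) (A : nat -> algC) :
  (forall s, s \in S -> in_Zadj beta s) -> in_Zadj beta pi ->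
  (forall k, (k <= D)%N -> in_Zadj beta (A k)) ->
  exists c : data_code, describes_data c beta xi S r pi D A.
Proof.
move=> SP [p pE] AP.
have [cb cbP] := describes_ex beta; have [cx cxP] := describes_ex xi.
have [cS SE] := in_Zadj_seq SP.
have [|cA AE] := @in_Zadj_seq beta (mkseq A D.+1).
  by move=> x /mapP[k]; rewrite mem_iota => /andP[_ kD] ->; apply: AP.
by exists (cb, cx, cS, r, p, cA); split=> //; rewrite SE.
Qed.

(* Main.v *)
Require Import Defs.
From HB Require Import structures.
From mathcomp Require Import all_boot all_order all_algebra all_field.
From mathcomp Require Import all_classical all_reals all_analysis.
From mathcomp Require Import ring lra zify.

Set Implicit Arguments.
Unset Strict Implicit.
Unset Printing Implicit Defensive.

Import Order.TTheory GRing.Theory Num.Theory.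
Import numFieldNormedType.Exports.

Local Open Scope ring_scope.

(* Multiplying the relation sum_k A_k xi^k = 0 by (beta - 1)^D turns it into a
   relation between the powers of eta = (beta - 1) xi beta^-r, whose digits in
   base beta are the differences of consecutive t_n, so that at most
   gamma(N) + r + 1 of the first N of them are nonzero.  The powers eta^k,
   k <= D, then have at most D (gamma(N) + r + 1)^D nonzero digits in all, and
   if gamma(N) is small a window (R, R + g] with g of order log N contains none
   of them.  Truncating the powers of eta after the index R and multiplying by
   beta^R gives an element W of Z[beta].  It is nonzero by (ii) and (iii), and
   its conjugates, apart from W and its complex conjugate, are polynomially
   bounded in N because the conjugates of beta lie in the closed unit disc; as
   the norm of W is a nonzero integer, |W| is at least a negative power of N.
   But the window makes |W| at most |beta|^-g times a power of N, which is a
   contradiction.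

   Effectivity needs only a lower bound for |beta| - 1, which comes from the
   integrality of the product of the nonzero numbers z z' - 1 over pairs of
   conjugates z, z' of beta.  All constants are then explicit functions of a
   bound for the coefficients and degrees of the integer polynomials in the
   data, and the code of the data is such a bound. *)

(** * Recursive functions and codes *)

Lemma recursive_ext k (f g : k.-tuple nat -> nat) :
  f =1 g -> recursive f -> recursive g.
Proof.
move=> fg rf; apply: (rec_comp (g := fun i v => tnth v i) rf).
  by move=> i; apply: rec_proj.
move=> v; rewrite -fg; congr f; apply: eq_from_tnth => i.
by rewrite tnth_mktuple.
Qed.

Lemma recursive_comp1 k (f : 1.-tuple nat -> nat) (g : k.-tuple nat -> nat) :
  recursive f -> recursive g -> recursive (fun v => f [tuple g v]).
Proof.
move=> rf rg; apply: (rec_comp (g := fun=> g) rf) => // v.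
congr f; apply: eq_from_tnth => i; rewrite tnth_mktuple.
by rewrite (ord1 i).
Qed.

Lemma recursive_comp2 k (f : 2.-tuple nat -> nat) (g h : k.-tuple nat -> nat) :
  recursive f -> recursive g -> recursive h ->
  recursive (fun v => f [tuple g v; h v]).
Proof.
move=> rf rg rh.
apply: (rec_comp (g := fun i => if i == ord0 then g else h) rf) => [i|v].
  by case: ifP.
congr f; apply: eq_from_tnth => i; rewrite tnth_mktuple.
by case: i => [[|[|//]]] //= i; rewrite !(tnth_nth 0%N).
Qed.

Lemma recursive_succ k (g : k.-tuple nat -> nat) :
  recursive g -> recursive (fun v => (g v).+1).
Proof. by move=> rg; exact: recursive_comp1 rec_succ rg. Qed.

Lemma recursive_const k n : recursive (fun _ : k.-tuple nat => n).
Proof. by elim: n => [|n IH]; [exact: rec_zero|exact: recursive_succ]. Qed.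

(** Primitive recursion on the first argument with a step that does not see the recursion index.
    Sums, products, powers and truncated differences are instances. *)
Lemma recursive_iter2 (F : nat -> nat -> nat) (base : nat -> nat)
    (op : nat -> nat -> nat) :
  recursive (fun v : 1.-tuple nat => base (tnth v ord0)) ->
  recursive (fun v : 2.-tuple nat => op (tnth v ord0) (tnth v ord_max)) ->
  (forall m, F 0%N m = base m) -> (forall n m, F n.+1 m = op (F n m) m) ->
  recursive (fun v : 2.-tuple nat => F (tnth v ord0) (tnth v ord_max)).
Proof.
move=> rb ro F0 FS.
apply: (@rec_prim 1 _ (fun v : 3.-tuple nat =>
   op (tnth v (Ordinal (isT : 1 < 3)%N)) (tnth v ord_max)) _ rb).
- have := @recursive_comp2 3 _ _ _ ro (rec_proj (Ordinal (isT : 1 < 3)%N))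
    (rec_proj ord_max).
  by apply: recursive_ext => v; rewrite !(tnth_nth 0%N).
- by move=> v; rewrite !(tnth_nth 0%N) /= F0.
- by move=> n v; rewrite !(tnth_nth 0%N) /= FS.
Qed.

Lemma recursive_op2 (F : nat -> nat -> nat) k (g h : k.-tuple nat -> nat) :
  recursive (fun v : 2.-tuple nat => F (tnth v ord0) (tnth v ord_max)) ->
  recursive g -> recursive h -> recursive (fun v => F (g v) (h v)).
Proof.
move=> rF rg rh; have := recursive_comp2 rF rg rh.
by apply: recursive_ext => v; rewrite !(tnth_nth 0%N).
Qed.

Lemma recursive_add k (g h : k.-tuple nat -> nat) :
  recursive g -> recursive h -> recursive (fun v => g v + h v)%N.
Proof.
apply: (@recursive_op2 addn).
apply: (@recursive_iter2 addn id (fun x _ => x.+1)) => //; first exact: rec_proj.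
exact: recursive_succ (rec_proj _).
Qed.

Lemma recursive_mul k (g h : k.-tuple nat -> nat) :
  recursive g -> recursive h -> recursive (fun v => g v * h v)%N.
Proof.
apply: (@recursive_op2 muln).
apply: (@recursive_iter2 muln (fun=> 0%N) (fun x m => (m + x)%N)) => //.
  exact: rec_zero.
exact: recursive_add (rec_proj _) (rec_proj _).
Qed.

Lemma recursive_exp k (g h : k.-tuple nat -> nat) :
  recursive g -> recursive h -> recursive (fun v => g v ^ h v)%N.
Proof.
(* The recursion runs on the exponent, so the arguments are swapped. *)
move=> rg rh; move: rh rg; apply: (@recursive_op2 (fun x y => y ^ x)%N).
apply: (@recursive_iter2 (fun x y => y ^ x)%N (fun=> 1%N)
  (fun x m => (m * x)%N)) => //.
- exact: recursive_const.
- exact: recursive_mul (rec_proj _) (rec_proj _).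
- by move=> n m; rewrite expnS.
Qed.

Lemma recursive_pred k (g : k.-tuple nat -> nat) :
  recursive g -> recursive (fun v => (g v).-1).
Proof.
move=> rg; have r2 : recursive (fun v : 1.-tuple nat => (tnth v ord0).-1).
  apply: (@rec_prim 0 (fun=> 0%N) (fun v => tnth v ord0)).
  - exact: rec_zero.
  - exact: rec_proj.
  - by move=> v; rewrite (tnth_nth 0%N).
  - by move=> n v; rewrite !(tnth_nth 0%N).
by apply: recursive_ext (recursive_comp1 r2 rg) => v; rewrite (tnth_nth 0%N).
Qed.

Lemma recursive_sub k (g h : k.-tuple nat -> nat) :
  recursive g -> recursive h -> recursive (fun v => g v - h v)%N.
Proof.
move=> rg rh; move: rh rg; apply: (@recursive_op2 (fun x y => y - x)%N).
apply: (@recursive_iter2 (fun x y => y - x)%N id (fun x _ => x.-1)) => //.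
- exact: rec_proj.
- exact: recursive_pred (rec_proj _).
- by move=> n; rewrite subn0.
- by move=> n m; rewrite subnS.
Qed.

Lemma effectively_computable_nat (R : realType) (T : countType)
    (G : nat -> nat) :
  recursive (fun v : 2.-tuple nat => G (tnth v ord0)) ->
  @effectively_computable R T (fun x => (G (pickle x))%:R).
Proof.
move=> rG; exists (fun v => G (tnth v ord0) * 2 ^ tnth v ord_max)%N.
  by apply: recursive_mul rG (recursive_exp (recursive_const _ _) (rec_proj _)).
move=> x k; rewrite !(tnth_nth 0%N) /= natrM natrX mulfK ?subrr ?normr0.
  by rewrite invr_ge0 exprn_ge0.
by rewrite expf_neq0 // pnatr_eq0.
Qed.

(** The numerator is [2 ^ (k - F)] with truncated subtraction. It is exact when [F <= k]; otherwise
    it is 1, and both the value and its approximation lie between 0 and [2^-k]. *)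
Lemma effectively_computable_exp2N (R : realType) (T : countType)
    (F : nat -> nat) :
  recursive (fun v : 2.-tuple nat => F (tnth v ord0)) ->
  @effectively_computable R T (fun x => (2 ^+ F (pickle x))^-1).
Proof.
move=> rF; exists (fun v => 2 ^ (tnth v ord_max - F (tnth v ord0)))%N.
  apply: recursive_exp; first exact: recursive_const.
  exact: recursive_sub (rec_proj _) rF.
move=> x k; rewrite !(tnth_nth 0%N) /=; set n := F _.
have p2 m : 0 < 2 ^+ m :> R by rewrite exprn_gt0.
have [nk|kn] := leqP n k.
  have -> : 2 ^+ k = 2 ^+ (k - n) * 2 ^+ n :> R by rewrite -exprD subnK.
  rewrite natrX invfM mulrA divff ?gt_eqF // mul1r subrr normr0.
  by rewrite mulr_ge0 ?invr_ge0 ?ltW.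
rewrite (eqP (ltnW kn : (k - n == 0)%N)) expn0 mul1r distrC ger0_norm.
  by rewrite gerBl invr_ge0 ltW.
by rewrite subr_ge0 lef_pV2 ?posrE // ler_weXn2l ?ler1n // ltnW.
Qed.

Lemma code_mem_lt (s : seq nat) n : n \in s -> (n < CodeSeq.code s)%N.
Proof. by move/(allP (CodeSeq.ltn_code s)). Qed.

Lemma size_code (s : seq nat) : (size s <= CodeSeq.code s)%N.
Proof.
elim: s => //= n s IH; have : (0 < 2 ^ n)%N by rewrite expn_gt0.
by set a := (2 ^ n)%N; nia.
Qed.

Lemma pickle_pairl (T1 T2 : countType) (p : (T1 * T2)%type) :
  (pickle p.1 <= pickle p)%N.
Proof. by apply/ltnW/code_mem_lt; rewrite mem_head. Qed.

Lemma pickle_pairr (T1 T2 : countType) (p : (T1 * T2)%type) :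
  (pickle p.2 <= pickle p)%N.
Proof. by apply/ltnW/code_mem_lt; rewrite !inE eqxx orbT. Qed.

Lemma pickle_seq_mem (T : countType) (s : seq T) x :
  x \in s -> (pickle x <= pickle s)%N.
Proof.
by move=> xs; apply/ltnW/code_mem_lt/map_f.
Qed.

Lemma pickle_seq_size (T : countType) (s : seq T) :
  (size s <= pickle s)%N.
Proof. by rewrite -(size_map pickle); exact: size_code. Qed.

Lemma pickle_int (z : int) : (`|z| <= pickle z)%N.
Proof.
have aux (n : nat) : (n <= pickle (Some n))%N.
  exact: (@pickle_seq_mem _ [:: n] n (mem_head _ _)).
case: z => n /=.
  apply: leq_trans (aux n) _.
  exact: (@pickle_pairl _ _ (Some n, None : option nat)).
(* The absolute value of [Negz n] is [n + 1], so the strict bound of [code_mem_lt] is needed. *)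
apply: (@leq_trans (pickle (Some n)).+1); first by rewrite ltnS.
apply: (@code_mem_lt [:: pickle (None : option nat); pickle (Some n)]).
by rewrite !inE eqxx orbT.
Qed.

Lemma pickle_poly_coef (p : {poly int}) i : (`|(p`_i)%R| <= pickle p)%N.
Proof.
have [ip|ip] := ltnP i (size p); last by rewrite nth_default.
apply: leq_trans (pickle_int _) _.
exact: (@pickle_seq_mem _ (p : seq int) p`_i (mem_nth _ ip)).
Qed.

Lemma pickle_poly_size (p : {poly int}) : (size p <= pickle p)%N.
Proof. exact: (@pickle_seq_size _ (p : seq int)). Qed.

(** * Norms of algebraic integers *)

(** Multiplication by [W] on [A[X]/(p)] has a matrix over [A]. Over [K] the Vandermonde matrix of
    the roots diagonalizes it, with the values of [W] at the roots as eigenvalues, so their product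
    is the image of a determinant over [A]. *)
Lemma prod_roots_in (A : comNzRingType) (K : idomainType)
    (f : {rmorphism A -> K}) (p W : {poly A}) (rs : seq K) :
  map_poly f p = \prod_(z <- rs) ('X - z%:P) -> p \is monic -> uniq rs ->
  exists a, f a = \prod_(z <- rs) (map_poly f W).[z].
Proof.
move=> pE p_mon rs_uniq.
pose d := size rs.
(* The coefficients of [r i] form row [i] of the multiplication matrix. *)
pose r i := Pdiv.Ring.rmodp ('X^i * W) p.
pose M := \matrix_(i < d, j < d) (r i)`_j.
pose v := \row_(j < d) rs`_j.
have size_p : size p = d.+1.
  rewrite -(size_prod_XsubC rs idfun) -pE size_map_poly_id0 //.
  by rewrite (monicP p_mon) rmorph1 oner_neq0.
have size_r i : (size (r i) <= d)%N.
  by rewrite -ltnS -size_p Pdiv.Ring.ltn_rmodpN0 // monic_neq0.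
have rE (i j : 'I_d) :
    (map_poly f (r i)).[rs`_j] = rs`_j ^+ i * (map_poly f W).[rs`_j].
  have := Pdiv.RingMonic.rdivp_eq p_mon ('X^i * W).
  move/(congr1 (fun q => (map_poly f q).[rs`_j])).
  rewrite rmorphD !rmorphM /= map_polyXn !hornerE /= => ->.
  have /rootP-> : root (map_poly f p) rs`_j.
    by rewrite pE root_prod_XsubC mem_nth.
  by rewrite mulr0 add0r.
have MV : map_mx f M *m Vandermonde d v =
    Vandermonde d v *m diag_mx (\row_j (map_poly f W).[rs`_j]).
  apply/matrixP => i j; rewrite mul_mx_diag !mxE -rE.
  rewrite (horner_coef_wide _ (leq_trans (size_poly _ _) (size_r i))).
  by apply: eq_bigr => k _; rewrite !mxE coef_map.
have V0 : \det (Vandermonde d v) != 0.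
  rewrite det_Vandermonde; apply/prodf_neq0 => i _; apply/prodf_neq0 => j ij.
  by rewrite !mxE subr_eq0 nth_uniq // gtn_eqF.
exists (\det M); rewrite -det_map_mx; apply: (mulIf V0).
rewrite -det_mulmx MV det_mulmx mulrC det_diag; congr (_ * _).
rewrite (big_nth 0) big_mkord; apply: eq_bigr => i _; by rewrite mxE.
Qed.

(** Either the gcd or its cofactor in [p] vanishes at [x]. The gcd cannot, as it divides [q]; so the
    cofactor does, is divisible by [p] by minimality, and the gcd is constant. *)
Lemma minCpoly_coprime (x : algC) (p q : {poly rat}) :
  minCpoly x = map_poly ratr p -> ~~ root (map_poly ratr q) x -> coprimep p q.
Proof.
move=> pE qx; have [p' [Dp' p'_mon] p'P] := minCpolyP x.
have {Dp'} pp' : p' = p.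
  by apply: (@map_poly_inj rat algC ratr); rewrite -pE Dp'.
rewrite {}pp' in p'_mon p'P.
have p0 := monic_neq0 p'_mon.
have /dvdpP[h ph] := dvdp_gcdl p q.
have h0 : h != 0 by apply: contra_neq p0 => h0; rewrite ph h0 mul0r.
have g0 : gcdp p q != 0 by rewrite gcdp_eq0 negb_and p0.
have: root (map_poly ratr p) x by rewrite -pE root_minCpoly.
rewrite {1}ph rmorphM rootM => /orP[|gx].
  rewrite p'P => /(dvdp_leq h0); rewrite {1}ph size_mul //.
  rewrite coprimep_def; move: g0 h0; rewrite -!size_poly_gt0.
  move: (size _) (size _) => a b; lia.
have /dvdpP[k qk] := dvdp_gcdr p q.
by move: qx; rewrite qk rmorphM rootM gx orbT.
Qed.

(** In characteristic 0 the derivative is nonzero and of smaller degree, so it does not vanish at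
    [x] and is coprime to the minimal polynomial. *)
Lemma minCpoly_roots (x : algC) : exists2 rs : seq algC, uniq rs &
  minCpoly x = \prod_(z <- rs) ('X - z%:P).
Proof.
have [rs] := closed_field_poly_normal (minCpoly x).
rewrite (monicP (minCpoly_monic x)) scale1r => rsE.
exists rs => //; rewrite -separable_prod_XsubC -rsE.
have [p [pE p_mon] pP] := minCpolyP x.
have p1 : (1 < size p)%N by have := size_minCpoly x; rewrite pE size_map_poly.
have dp0 : p^`() != 0.
  apply/eqP => /polyP/(_ (size p).-2); rewrite coef_deriv coef0 /=.
  have -> : (size p).-2.+1 = (size p).-1 by lia.
  by move/eqP; rewrite -lead_coefE (monicP p_mon) pnatr_eq0; lia.
rewrite pE separable_poly.unlock deriv_map coprimep_map.
apply: (minCpoly_coprime pE); rewrite pP; apply/negP => /(dvdp_leq dp0).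
by rewrite leqNgt lt_size_deriv // monic_neq0.
Qed.

Lemma zeval_prod_conj (beta : algC) (rs : seq algC) (W : {poly int}) :
  beta \in Aint -> uniq rs -> minCpoly beta = \prod_(z <- rs) ('X - z%:P) ->
  exists a : int, a%:~R = \prod_(z <- rs) zeval W z.
Proof.
(* Membership in [Aint] says that the minimal polynomial has integer coefficients; [p] is that
   polynomial over [int]. *)
move=> /floorpP[p pE] rs_uniq rsE.
apply: (@prod_roots_in _ _ (intr : {rmorphism int -> algC}) p W rs) => //.
  by rewrite -rsE pE.
have := minCpoly_monic beta; rewrite pE !monicE lead_coef_map_inj //.
  by move/eqP/(congr1 (@Num.floor _)); rewrite intrKfloor floor1 => ->.
exact: intr_inj.
Qed.

Lemma zeval_conj_neq0 (beta z : algC) (W : {poly int}) :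
  zeval W beta != 0 -> conjugates_over_Q beta z -> zeval W z != 0.
Proof.
have [p [pE p_mon] pP] := minCpolyP beta.
rewrite /conjugates_over_Q pE => W0 pz.
have WE x : zeval W x = (map_poly ratr (map_poly intr W : {poly rat})).[x].
  by rewrite /zeval -map_poly_comp; congr _.[_]; apply: eq_map_poly => k /=; rewrite ratr_int.
rewrite WE; apply: (@coprimep_root _ (map_poly ratr p)) => //.
rewrite coprimep_map; apply: minCpoly_coprime pE _.
by rewrite /root -WE.
Qed.

Lemma norm_int_ge1 (a : int) : a%:~R != 0 :> algC -> 1 <= `|a%:~R : algC|.
Proof. by rewrite intr_eq0 -intr_norm ler1z => a0; lia. Qed.

Lemma norm_prod_le (T : eqType) (s : seq T) (F : T -> algC) (U : algC) :
  0 <= U -> {in s, forall z, `|F z| <= U} ->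
  `|\prod_(z <- s) F z| <= U ^+ size s.
Proof.
move=> U0; elim: s => [|z s IH] FU; first by rewrite big_nil normr1.
rewrite big_cons normrM exprS ler_pM ?FU ?mem_head // IH // => y ys.
by rewrite FU // inE ys orbT.
Qed.

(** The product of the values of [W] at all conjugates is a nonzero integer, and at most [n] factors
    remain besides the one at [beta]. If that one is at most 1 in absolute value, so is the factor
    at [beta^*], and [U] bounds it too; otherwise the claim is immediate. *)
Lemma zeval_lower_bound (beta : algC) (W : {poly int}) (U : algC) (n : nat) :
  beta \in Aint -> zeval W beta != 0 -> 1 <= U ->
  (size (minCpoly beta) <= n.+1)%N ->
  (forall z, conjugates_over_Q beta z -> z != beta -> z != beta^* ->
     `|zeval W z| <= U) ->
  1 <= `|zeval W beta| * U ^+ n.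
Proof.
move=> bA W0 U1 sn WU; have [rs rs_uniq rsE] := minCpoly_roots beta.
have rsP z : (z \in rs) = conjugates_over_Q beta z.
  by rewrite /conjugates_over_Q rsE root_prod_XsubC.
have [Wb1|Wb1] := boolP (1 <= `|zeval W beta|).
  by rewrite -[leLHS]mulr1 ler_pM // exprn_ege1.
have {Wb1} Wb1 : `|zeval W beta| <= 1.
  by case: (real_leP (real1 _) (normr_real (zeval W beta))) Wb1 => // /ltW.
have [a aE] := zeval_prod_conj W bA rs_uniq rsE.
have bs : beta \in rs by rewrite rsP; exact: root_minCpoly.
have /norm_int_ge1 : a%:~R != 0 :> algC.
  rewrite aE prodf_seq_neq0; apply/allP => z zs /=.
  by apply: zeval_conj_neq0 W0 _; rewrite -rsP.
move/le_trans; apply; rewrite aE (big_rem beta) //= normrM ler_wpM2l //.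
apply: (@le_trans _ _ (U ^+ size (rem beta rs))).
  apply: norm_prod_le => [|z]; first exact: le_trans U1.
  rewrite mem_rem_uniq // inE => /andP[zb zs].
  have [->|zb'] := eqVneq z (beta^*); last by rewrite WU // -rsP.
  suff -> : zeval W beta^* = (zeval W beta)^* by rewrite norm_conjC (le_trans Wb1).
  rewrite /zeval -[RHS]horner_map -map_poly_comp; congr _.[_].
  by apply: eq_map_poly => k /=; rewrite rmorph_int.
rewrite ler_weXn2l // size_rem // -ltnS.
by apply: leq_trans sn; rewrite rsE size_prod_XsubC ltnS leq_pred.
Qed.

(* The two applications of [prod_roots_in] run over the conjugates [z'], with
   indeterminates [X] and [Y], of [X + 1 - Y z'], and then over the conjugates
   [z] put for [Y]. *)
Lemma prod_conj_pairs_int (beta : algC) (rs : seq algC) :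
  beta \in Aint -> uniq rs -> minCpoly beta = \prod_(z <- rs) ('X - z%:P) ->
  exists q : {poly int},
    map_poly intr q = \prod_(z <- [seq x * y - 1 | x <- rs, y <- rs]) ('X - z%:P).
Proof.
move=> /floorpP[p pE] rs_uniq rsE.
have p_mon : p \is monic.
  have := minCpoly_monic beta; rewrite pE !monicE lead_coef_map_inj //.
    by move/eqP/(congr1 (@Num.floor _)); rewrite intrKfloor floor1 => ->.
  exact: intr_inj.
pose f1 : {rmorphism {poly int} -> {poly algC}} := map_poly intr.
pose f2 : {rmorphism {poly {poly int}} -> {poly {poly algC}}} := map_poly f1.
have polyC_uniq (T : nzRingType) (s : seq T) : uniq s -> uniq [seq z%:P | z <- s].
  by move=> us; rewrite map_inj_uniq //; exact: polyC_inj.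
have E1 : map_poly f1 (map_poly polyC p) =
    \prod_(z <- [seq z%:P | z <- rs]) ('X - z%:P).
  rewrite -map_poly_comp (eq_map_poly (g := polyC \o intr)); last first.
    by move=> k /=; rewrite map_polyC.
  rewrite map_poly_comp -pE rsE big_map rmorph_prod; apply: eq_bigr => z _.
  by rewrite rmorphB /= map_polyX map_polyC.
have E2 : map_poly f2 (map_poly polyC (map_poly polyC p)) =
    \prod_(z <- [seq z%:P | z <- [seq z%:P | z <- rs]]) ('X - z%:P).
  rewrite -map_poly_comp (eq_map_poly (g := polyC \o f1)); last first.
    by move=> k /=; rewrite map_polyC.
  rewrite map_poly_comp E1 rmorph_prod !big_map.
  apply: eq_bigr => z _; by rewrite rmorphB /= map_polyX map_polyC.
have [G GE] := prod_roots_in (('X + 1)%:P%:P - 'X%:P * 'X) E2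
  (monic_map _ (monic_map _ p_mon)) (polyC_uniq _ _ (polyC_uniq _ _ rs_uniq)).
have [q qE] := prod_roots_in G E1 (monic_map _ p_mon) (polyC_uniq _ _ rs_uniq).
exists q; rewrite -/(f1 q) qE big_map big_allpairs_dep /=.
apply: eq_bigr => x _; rewrite -/(f2 G) GE !big_map.
rewrite horner_prod; apply: eq_bigr => y _.
rewrite rmorphB rmorphM /= map_polyX !map_polyC /= map_polyX map_polyC /=.
rewrite rmorphD /= map_polyX rmorph1 !hornerE /= polyCB polyCM polyC1.
ring.
Qed.

(** Up to sign the product is the lowest nonzero coefficient of [q]: one has [q = h * 'X^m] with [h]
    collecting the nonzero roots. *)
Lemma prod_roots_neq0_ge1 (q : {poly int}) (s : seq algC) :
  map_poly intr q = \prod_(z <- s) ('X - z%:P) ->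
  1 <= `|\prod_(z <- s | z != 0) z|.
Proof.
move=> qE.
pose m := count (pred1 0) s; pose h := \prod_(z <- s | z != 0) ('X - z%:P).
have E : map_poly intr q = h * 'X^m.
  rewrite qE (bigID (fun z => z != 0)) /=; congr (_ * _).
  rewrite -big_filter (eq_big_seq (fun=> 'X)); last first.
    by move=> z; rewrite mem_filter negbK => /andP[/eqP-> _]; rewrite subr0.
  rewrite big_const_seq count_predT size_filter /m.
  rewrite (@eq_count _ _ (pred1 0)) => [|z /=]; last by rewrite negbK.
  by elim: (count _ _) => //= k ->; rewrite exprS.
have hE : h`_0 = (q`_m)%:~R.
  by rewrite -[in RHS](coef_map intr) E coefMXn ltnn subnn.
have h0 : h`_0 = \prod_(z <- s | z != 0) (- z).
  rewrite -horner_coef0 horner_prod; apply: eq_bigr => z _.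
  by rewrite !hornerE.
have -> : `|\prod_(z <- s | z != 0) z| = `|h`_0|.
  by rewrite h0 !normr_prod; apply: eq_bigr => z _; rewrite normrN.
rewrite hE; apply: norm_int_ge1; rewrite -hE h0.
by rewrite prodf_seq_neq0; apply/allP => z _ /=; apply/implyP; rewrite oppr_eq0.
Qed.

(* [|beta|^2 - 1] is one of the [z z' - 1] for conjugates [z] and [z']
   of [beta], and the product of those that do not vanish is an integer. *)
Lemma norm_gap (beta : algC) (H n : nat) :
  beta \in Aint -> 1 < `|beta| -> `|beta| <= H%:R ->
  (forall z, conjugates_over_Q beta z -> `|z| <= `|beta|) ->
  (size (minCpoly beta) <= n.+1)%N ->
  1 <= (`|beta| ^+ 2 - 1) * (H ^ 2 + 1)%:R ^+ (n * n).
Proof.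
move=> bA b1 bH bz sn; have [rs rs_uniq rsE] := minCpoly_roots beta.
have rsP z : (z \in rs) = conjugates_over_Q beta z.
  by rewrite /conjugates_over_Q rsE root_prod_XsubC.
have srs : (size rs <= n)%N by rewrite -ltnS (leq_trans _ sn) // rsE size_prod_XsubC.
have [q qE] := prod_conj_pairs_int bA rs_uniq rsE.
move/prod_roots_neq0_ge1: qE => /le_trans; apply.
set s := [seq _ | _ <- _, _ <- _].
have d0 : beta * beta^* - 1 = `|beta| ^+ 2 - 1 by rewrite normCK.
have d1 : 0 < `|beta| ^+ 2 - 1 by rewrite subr_gt0 expr_gt1.
have ds : `|beta| ^+ 2 - 1 \in [seq z <- s | z != 0].
  rewrite mem_filter gt_eqF //= -d0.
  apply: (allpairs_f (fun x y => x * y - 1)).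
    by rewrite rsP; exact: root_minCpoly.
  rewrite rsP /conjugates_over_Q -(minCpoly_aut Num.conj_op).
  exact: root_minCpoly.
rewrite -big_filter (big_rem _ ds) /= normrM gtr0_norm // ler_wpM2l ?(ltW d1) //.
set B : algC := (H ^ 2 + 1)%:R; have B1 : 1 <= B by rewrite ler1n addn1.
apply: (@le_trans _ _
  (B ^+ size (rem (`|beta| ^+ 2 - 1) [seq z <- s | z != 0]))).
  apply: (norm_prod_le (F := id)) => [|z]; first exact: le_trans B1.
  move/mem_rem; rewrite mem_filter => /andP[_ /allpairsP[[x y] /= [xs ys ->]]].
  rewrite (le_trans (ler_normB _ _)) // normr1 /B natrD lerD2r normrM natrX expr2.
  by rewrite ler_pM // (le_trans (bz _ _)) // -rsP.
rewrite ler_weXn2l // size_rem // (leq_trans (leq_pred _)) //.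
rewrite size_filter (leq_trans (count_size _ _)) // size_allpairs.
exact: leq_mul.
Qed.

(** * Coefficients of products of polynomials *)

Definition norm1 (K : numDomainType) (p : {poly K}) : K :=
  \sum_(i < size p) `|p`_i|.

Lemma norm1_wide (K : numDomainType) (p : {poly K}) n :
  (size p <= n)%N -> norm1 p = \sum_(i < n) `|p`_i|.
Proof.
move=> pn; rewrite /norm1 (big_ord_widen n (fun i => `|p`_i|) pn).
rewrite big_mkcond; apply: eq_bigr => i _; case: ltnP => // ip.
by rewrite nth_default ?normr0.
Qed.

Lemma sum_norm_coef_le (K : numDomainType) (p : {poly K}) n :
  \sum_(i < n) `|p`_i| <= norm1 p.
Proof.
rewrite (norm1_wide (leq_addr n (size p))) addnC big_split_ord /= lerDl.
exact: sumr_ge0.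
Qed.

Lemma norm1_ge0 (K : numDomainType) (p : {poly K}) : 0 <= norm1 p.
Proof. exact: sumr_ge0. Qed.

(** [norm1 p] is the value at 1 of the polynomial [a p] of absolute values, and the coefficients of
    [p * q] are dominated by those of [a p * a q]. *)
Lemma norm1M (K : numDomainType) (p q : {poly K}) :
  norm1 (p * q) <= norm1 p * norm1 q.
Proof.
pose a (p : {poly K}) := \poly_(i < size p) `|p`_i|.
have aE (s : {poly K}) i : (a s)`_i = `|s`_i|.
  by rewrite coef_poly; case: ltnP => // si; rewrite nth_default ?normr0.
have a1 (s : {poly K}) : (a s).[1] = norm1 s.
  rewrite horner_poly; apply: eq_bigr => i _.
  by rewrite expr1n mulr1.
have sa (s : {poly K}) : (size (a s) <= size s)%N by exact: size_poly.
pose n := (size p + size q)%N.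
have n1 : (size (p * q)%R <= n)%N.
  by rewrite (leq_trans (size_polyMleq _ _)) // leq_pred.
have n2 : (size (a p * a q)%R <= n)%N.
  by rewrite (leq_trans (size_polyMleq _ _)) // (leq_trans (leq_pred _)) // leq_add.
rewrite -!a1 -hornerM (horner_coef_wide _ n2) a1 (norm1_wide n1).
apply: ler_sum => i _; rewrite expr1n mulr1 !coefM.
by apply: le_trans (ler_norm_sum _ _ _) _; apply: ler_sum => j _; rewrite !aE normrM.
Qed.

Lemma norm1X (K : numDomainType) (p : {poly K}) k :
  norm1 (p ^+ k) <= norm1 p ^+ k.
Proof.
elim: k => [|k IH].
  by rewrite !expr0 /norm1 size_poly1 big_ord1 coef1 normr1.
rewrite !exprS (le_trans (norm1M _ _)) // ler_wpM2l //; exact: norm1_ge0.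
Qed.

Lemma norm_horner_le1 (K : numDomainType) (p : {poly K}) x :
  `|x| <= 1 -> `|p.[x]| <= norm1 p.
Proof.
move=> x1; rewrite horner_coef (le_trans (ler_norm_sum _ _ _)) //.
by apply: ler_sum => i _; rewrite normrM normrX ler_piMr // exprn_ile1.
Qed.

Lemma norm_horner_ge1 (K : numDomainType) (p : {poly K}) x n :
  1 <= `|x| -> (size p <= n)%N -> `|p.[x]| <= norm1 p * `|x| ^+ n.
Proof.
move=> x1 pn; rewrite horner_coef (le_trans (ler_norm_sum _ _ _)) //.
rewrite mulr_suml; apply: ler_sum => i _; rewrite normrM normrX ler_wpM2l //.
by rewrite ler_weXn2l // ltnW // (leq_trans (ltn_ord i)).
Qed.

(** Beyond [R], the terms inside the gap vanish and all later ones contain the factor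
    [b ^+ (R + g)]. *)
Lemma norm_horner_gap (K : numDomainType) (p : {poly K}) b R g :
  `|b| <= 1 -> (forall m, (R < m <= R + g)%N -> p`_m = 0) ->
  `|p.[b] - \sum_(m < R.+1) p`_m * b ^+ m| <= `|b| ^+ (R + g) * norm1 p.
Proof.
move=> b1 gap; pose n := (R.+1 + size p)%N.
have sn : (size p <= n)%N by exact: leq_addl.
rewrite (horner_coef_wide _ sn) big_split_ord /= addrAC subrr add0r.
rewrite (le_trans (ler_norm_sum _ _ _)) // (norm1_wide sn) big_split_ord /=.
rewrite mulrDr ler_wpDl //; first by rewrite mulr_ge0 ?exprn_ge0 // sumr_ge0.
rewrite mulr_sumr; apply: ler_sum => i _; rewrite normrM normrX.
have [ig|gi] := leqP (R.+1 + i) (R + g).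
  by rewrite gap ?normr0 ?mul0r ?mulr0 // ig andbT addSn ltnS leq_addr.
rewrite mulrC ler_wpM2r // ler_wiXn2l //; exact: ltnW.
Qed.

Lemma norm_exprB_le (K : numDomainType) (x y Z : K) k :
  `|x| <= Z -> `|y| <= Z -> 1 <= Z ->
  `|x ^+ k - y ^+ k| <= k%:R * Z ^+ k * `|x - y|.
Proof.
move=> xZ yZ Z1; rewrite subrXX normrM mulrC ler_wpM2r //.
have Z0 : 0 <= Z by exact: le_trans Z1.
apply: le_trans (ler_norm_sum _ _ _) _.
rewrite -[k in k%:R]card_ord mulr_natl -sumr_const; apply: ler_sum => i _.
rewrite normrM !normrX.
apply: le_trans (_ : Z ^+ (k.-1 - i) * Z ^+ i <= _).
  by rewrite ler_pM ?exprn_ge0 // lerXn2r ?nnegrE.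
by rewrite -exprD ler_weXn2l //; have := ltn_ord i; lia.
Qed.

Definition supp (K : nzRingType) (p : {poly K}) : seq nat :=
  [seq i <- iota 0 (size p) | p`_i != 0].

Lemma mem_supp (K : nzRingType) (p : {poly K}) i : (i \in supp p) = (p`_i != 0).
Proof.
rewrite mem_filter mem_iota /= add0n andb_idr // => pi.
by rewrite ltnNge; apply: contra pi => /(nth_default 0)->.
Qed.

(** The support of a product lies in the sumset of the supports. *)
Lemma size_suppM (K : nzRingType) (p q : {poly K}) :
  (size (supp (p * q)%R) <= size (supp p) * size (supp q))%N.
Proof.
rewrite -(size_allpairs addn); apply: uniq_leq_size.
  by rewrite filter_uniq ?iota_uniq.
move=> m; rewrite mem_supp coefM => pq.
have [i pi] : exists i : 'I_m.+1, p`_i * q`_(m - i) != 0.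
  apply/existsP; apply: contra_neqT pq; rewrite negb_exists => /forallP h.
  by apply: big1 => i _; have /negPn/eqP := h i.
apply/allpairsP; exists (i : nat, (m - i)%N); split => /=.
- by rewrite mem_supp; apply: contra_neq pi => ->; rewrite mul0r.
- by rewrite mem_supp; apply: contra_neq pi => ->; rewrite mulr0.
- by rewrite subnKC // -ltnS.
Qed.

Lemma size_suppX (K : nzRingType) (p : {poly K}) k :
  (size (supp (p ^+ k)%R) <= size (supp p) ^ k)%N.
Proof.
elim: k => [|k IH]; first by rewrite expr0 /supp size_poly1 /= coef1 oner_neq0.
by rewrite exprS expnS (leq_trans (size_suppM _ _)) // leq_mul2l IH orbT.
Qed.

(** Pigeonhole on the [size s + 1] disjoint blocks [(j * g, (j + 1) * g]], [1 <= j <= size s + 1],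
    all contained in [[1, N]]. *)
Lemma ex_gap (s : seq nat) (g N : nat) :
  (0 < g)%N -> (size s + 2 <= N %/ g)%N ->
  exists2 R, (0 < R)%N & (R + g <= N)%N /\
    forall m, (R < m <= R + g)%N -> m \notin s.
Proof.
(* The blocks start at [j = 1] to make [R = j * g] positive, since condition (iii) concerns positive
   exponents only. *)
move=> g0 sN; pose js := iota 1 (size s).+1.
have [/hasP[j js_j /hasPn jP]|/hasPn nj] :=
    boolP (has (fun j => ~~ has (fun m => m.-1 %/ g == j)%N s) js).
  move: js_j; rewrite mem_iota => /andP[j1 js1].
  exists (j * g)%N; first by rewrite muln_gt0 j1.
  split=> [|m /andP[jm mj]].
    rewrite -mulSnr (leq_trans _ (leq_divM N g)) // leq_mul2r; lia.
  apply/negP => /jP/eqP; apply.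
  by apply/eqP; rewrite eqn_leq -ltnS ltn_divLR // leq_divRL //; nia.
have sub : {subset js <= [seq (m.-1 %/ g)%N | m <- s]}.
  move=> j /nj; rewrite negbK => /hasP[m ms /eqP<-]; exact: map_f.
have := uniq_leq_size (iota_uniq _ _) sub.
by rewrite size_map size_iota ltnn.
Qed.

(** * The truncated relation *)

Lemma natr_mul_sum (K : nzRingType) n (x : K) : n%:R * x = \sum_(k < n) x.
Proof. by rewrite sumr_const card_ord mulr_natl. Qed.

Definition zevalr (z : algC) : {rmorphism {poly int} -> algC} :=
  horner_eval z \o map_poly intr.

Arguments zevalr : simpl never.

Lemma zevalE z p : zeval p z = zevalr z p. Proof. by []. Qed.

Lemma in_Zadj0 beta : in_Zadj beta 0.
Proof. by exists 0; rewrite zevalE rmorph0. Qed.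

Lemma in_ZadjD beta x y : in_Zadj beta x -> in_Zadj beta y -> in_Zadj beta (x + y).
Proof. by move=> [p ->] [q ->]; exists (p + q); rewrite !zevalE rmorphD. Qed.

Lemma in_ZadjN beta x : in_Zadj beta x -> in_Zadj beta (- x).
Proof. by move=> [p ->]; exists (- p); rewrite !zevalE rmorphN. Qed.

Lemma in_ZadjM beta x y : in_Zadj beta x -> in_Zadj beta y -> in_Zadj beta (x * y).
Proof. by move=> [p ->] [q ->]; exists (p * q); rewrite !zevalE rmorphM. Qed.

Lemma in_Zadj_sum beta (I : Type) (s : seq I) (P : pred I) (F : I -> algC) :
  (forall i, P i -> in_Zadj beta (F i)) -> in_Zadj beta (\sum_(i <- s | P i) F i).
Proof.
move=> FP; elim/big_rec: _ => [|i x Pi]; first exact: in_Zadj0.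
exact: in_ZadjD (FP i Pi).
Qed.

Lemma zevalrX z : zevalr z 'X = z.
Proof. by rewrite /zevalr /= /horner_eval map_polyX hornerX. Qed.

(* With [P] the polynomial whose coefficients are the first digits of
   [(beta - 1) * xi * beta^-r] in base [beta], [trunc_rel] at [beta] is
   [beta^R] times the relation [(beta - 1)^D * \sum_k A_k xi^k], each power of
   [P] being truncated after the term of index [R]. *)
Definition trunc_rel (D r R : nat) (a : nat -> {poly int})
    (P : {poly {poly int}}) : {poly int} :=
  \sum_(k < D.+1) ('X - 1) ^+ (D - k) * a k * 'X ^+ (r * k) *
     \sum_(m < R.+1) (P ^+ k)`_m * 'X ^+ (R - m).

Lemma zeval_trunc_rel D r R a P z :
  zeval (trunc_rel D r R a P) z =
  \sum_(k < D.+1) (z - 1) ^+ (D - k) * zeval (a k) z * z ^+ (r * k) *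
     \sum_(m < R.+1) (map_poly (zevalr z) P ^+ k)`_m * z ^+ (R - m).
Proof.
rewrite zevalE rmorph_sum; apply: eq_bigr => k _.
rewrite !rmorphM !rmorphXn rmorphB rmorph1 !zevalrX; congr (_ * _).
rewrite rmorph_sum; apply: eq_bigr => m _.
by rewrite rmorphM rmorphXn zevalrX -rmorphXn coef_map.
Qed.

(** On the closed unit disc [z - 1] is at most 2 in absolute value, powers of [z] are at most 1, and
    the truncation of a polynomial is bounded by its [norm1], whatever [R] is. *)
Lemma norm_trunc_rel_conj D r R a P z (H L : algC) :
  `|z| <= 1 -> 1 <= L -> 0 <= H ->
  (forall k, (k <= D)%N -> `|zeval (a k) z| <= H) ->
  norm1 (map_poly (zevalr z) P) <= L ->
  `|zeval (trunc_rel D r R a P) z| <= D.+1%:R * (2 ^+ D * H * L ^+ D).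
Proof.
move=> z1 L1 H0 aH PL; rewrite zeval_trunc_rel.
apply: le_trans (ler_norm_sum _ _ _) _.
rewrite natr_mul_sum; apply: ler_sum => k _.
have kD : (k <= D)%N by rewrite -ltnS.
rewrite !normrM !normrX.
have -> : 2 ^+ D * H * L ^+ D = 2 ^+ D * H * 1 * L ^+ D by rewrite mulr1.
apply: ler_pM => //; rewrite ?mulr_ge0 ?exprn_ge0 //.
  apply: ler_pM => //; rewrite ?mulr_ge0 ?exprn_ge0 ?exprn_ile1 //.
  apply: ler_pM => //; rewrite ?exprn_ge0 ?aH //.
  apply: (@le_trans _ _ (2 ^+ (D - k))); last first.
    by rewrite ler_weXn2l ?leq_subr // ler1n.
  rewrite lerXn2r ?nnegrE // (le_trans (ler_normB _ _)) //.
  by rewrite normr1 -[2]/(1 + 1) lerD2r.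
apply: (@le_trans _ _ (norm1 (map_poly (zevalr z) P ^+ k))).
  apply: le_trans (ler_norm_sum _ _ _) _; apply: le_trans (sum_norm_coef_le _ R.+1).
  apply: ler_sum => i _; rewrite normrM normrX ler_piMr // exprn_ile1 //.
rewrite (le_trans (norm1X _ _)) //.
apply: (@le_trans _ _ (L ^+ k)); last by rewrite ler_weXn2l.
by rewrite lerXn2r ?nnegrE ?norm1_ge0 // (le_trans _ L1).
Qed.

(** Each truncated power of [P] is compared with [eta ^+ k]. The truncation error ([t1], from the
    gap) and the error of replacing [eta] by the value of [P] at [beta^-1] ([t2], from [R + g <= N])
    both contain [beta^-1] to the power [R + g], of which the factor [beta ^+ R] leaves [g]. *)
Lemma norm_trunc_rel_gap D r R g N a P (beta eta C Z : algC) :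
  1 < `|beta| -> 1 <= Z -> 0 <= C ->
  (forall k, (k <= D)%N ->
     `|(beta - 1) ^+ (D - k) * zeval (a k) beta * beta ^+ (r * k)| <= C) ->
  \sum_(k < D.+1) (beta - 1) ^+ (D - k) * zeval (a k) beta * beta ^+ (r * k)
     * eta ^+ k = 0 ->
  norm1 (map_poly (zevalr beta) P) <= Z -> `|eta| <= Z ->
  `|(map_poly (zevalr beta) P).[beta^-1] - eta| <= `|beta^-1| ^+ N * Z ->
  (R + g <= N)%N ->
  (forall k m, (1 <= k <= D)%N -> (R < m <= R + g)%N ->
     (map_poly (zevalr beta) P ^+ k)`_m = 0) ->
  `|zeval (trunc_rel D r R a P) beta| <=
     D.+1%:R * (C * (D.+1%:R * Z ^+ D.+1 * `|beta^-1| ^+ g)).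
Proof.
move=> b1 Z1 C0 cC rel PZ eZ Pe RgN gap; rewrite zeval_trunc_rel.
set p := map_poly (zevalr beta) P in PZ Pe gap *.
pose c (k : 'I_D.+1) := (beta - 1) ^+ (D - k) * zeval (a k) beta * beta ^+ (r * k).
have b0 : beta != 0 by rewrite -normr_gt0 (lt_trans _ b1).
have bi1 : `|beta^-1| <= 1 by rewrite normfV invf_le1 ?(lt_trans _ b1) // ltW.
have Z0 : 0 <= Z by exact: le_trans Z1.
(* Subtract [beta ^+ R] times the vanishing relation [rel]. *)
have -> : \sum_(k < D.+1) (beta - 1) ^+ (D - k) * zeval (a k) beta * beta ^+ (r * k)
      * \sum_(m < R.+1) (p ^+ k)`_m * beta ^+ (R - m)
  = \sum_(k < D.+1) c k * (beta ^+ R *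
      (\sum_(m < R.+1) (p ^+ k)`_m * beta^-1 ^+ m - eta ^+ k)).
  rewrite [RHS](eq_bigr (fun k : 'I_D.+1 =>
      beta ^+ R * (c k * \sum_(m < R.+1) (p ^+ k)`_m * beta^-1 ^+ m)
      - beta ^+ R * (c k * eta ^+ k))); last by move=> k _; ring.
  rewrite sumrB -!mulr_sumr rel mulr0 subr0 mulr_sumr; apply: eq_bigr => k _.
  rewrite mulrCA; congr (_ * _); rewrite mulr_sumr; apply: eq_bigr => m _.
  rewrite mulrCA; congr (_ * _).
  by rewrite exprVn expfB_cond // (negbTE b0) add0n -ltnS.
apply: le_trans (ler_norm_sum _ _ _) _.
rewrite natr_mul_sum.
apply: ler_sum => k _; have kD : (k <= D)%N by rewrite -ltnS.
rewrite normrM ler_pM // ?cC // normrM normrX.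
have bR : `|beta| ^+ R * `|beta^-1| ^+ (R + g) = `|beta^-1| ^+ g.
  by rewrite exprD mulrA -exprMn -normrM divff // normr1 expr1n mul1r.
rewrite -bR mulrCA ler_wpM2l ?exprn_ge0 // mulrC.
(* The gap is assumed for [k >= 1] only; for [k = 0] the truncation of the constant 1 is exact. *)
have [k0|k0] := posnP k.
  rewrite k0 !expr0 big_ord_recl /= coef1 eqxx mul1r expr0 big1; last first.
    by move=> i _; rewrite coef1 mul0r.
  by rewrite addr0 subrr normr0 !mulr_ge0 ?exprn_ge0.
have t1 : `|\sum_(m < R.+1) (p ^+ k)`_m * beta^-1 ^+ m - (p ^+ k).[beta^-1]| <=
     `|beta^-1| ^+ (R + g) * Z ^+ k.
  rewrite distrC (le_trans (norm_horner_gap bi1 (g := g) _)) //.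
    by move=> m mR; apply: gap => //; rewrite k0.
  rewrite ler_wpM2l ?exprn_ge0 // (le_trans (norm1X _ _)) //.
  by rewrite lerXn2r ?nnegrE ?norm1_ge0.
have t2 : `|(p ^+ k).[beta^-1] - eta ^+ k| <=
     `|beta^-1| ^+ (R + g) * (k%:R * Z ^+ k.+1).
  rewrite horner_exp (le_trans (norm_exprB_le k _ eZ Z1)) //.
    exact: le_trans (norm_horner_le1 _ bi1) PZ.
  rewrite exprSr mulrA mulrCA ler_wpM2l ?mulr_ge0 ?exprn_ge0 //.
  by rewrite (le_trans Pe) // ler_wpM2r // ler_wiXn2l.
rewrite -(subrK (p ^+ k).[beta^-1] (\sum_(m < R.+1) _)) -addrA.
rewrite (le_trans (ler_normD _ _)) // (le_trans (lerD t1 t2)) //.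
rewrite -mulrDr ler_wpM2l ?exprn_ge0 //.
apply: (@le_trans _ _ (Z ^+ D.+1 + k%:R * Z ^+ D.+1)).
  rewrite lerD ?ler_weXn2l ?leqW // ler_wpM2l // ler_weXn2l //.
by rewrite -[X in X + _]mul1r -mulrDl nat1r ler_wpM2r ?exprn_ge0 // ler_nat ltnS.
Qed.

(** The term [k = 0] is [(beta - 1)^D A_0 beta^R]. If the sum vanished, this term would be minus the
    sum of the others, which are [pi] times elements of [Z[beta]] by (ii), contradicting (iii) for
    [n = R]. *)
Lemma trunc_rel_neq0 (D r R : nat) (beta pi : algC) (a : nat -> {poly int})
    (P : {poly {poly int}}) :
  (0 < R)%N -> pi != 0 ->
  (forall k, (1 <= k <= D)%N ->
     in_Zadj beta ((beta - 1) ^+ (D - k) * zeval (a k) beta / pi)) ->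
  (forall n, (0 < n)%N ->
     ~ in_Zadj beta ((beta - 1) ^+ D * beta ^+ n * zeval (a 0%N) beta / pi)) ->
  zeval (trunc_rel D r R a P) beta != 0.
Proof.
move=> R0 pi0 aP a0; apply/eqP; rewrite zeval_trunc_rel big_ord_recl /= => E.
apply: (a0 R R0); move: E.
rewrite muln0 subn0 !expr0 mulr1 big_ord_recl coef1 mul1r subn0 big1; last first.
  by move=> i _; rewrite coef1 mul0r.
rewrite addr0 => /eqP; rewrite addr_eq0 => /eqP E.
rewrite [X in X / _]mulrAC E mulNr mulr_suml; apply/in_ZadjN/in_Zadj_sum => k _.
set S := \sum_(m < R.+1) _.
rewrite (_ : _ / pi = ((beta - 1) ^+ (D - bump 0 k) *
   zeval (a (bump 0 k)) beta / pi) * beta ^+ (r * bump 0 k) * S); last by ring.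
have bX n : in_Zadj beta (beta ^+ n).
  by exists ('X ^+ n); rewrite zevalE rmorphXn zevalrX.
apply: in_ZadjM; last first.
  apply: in_Zadj_sum => m _; apply: in_ZadjM => //.
  by rewrite -rmorphXn coef_map; exists (P ^+ bump 0 k)`_m.
by apply: in_ZadjM => //; apply: aP; rewrite /bump /= add1n ltn_ord.
Qed.

(** * Tails of the expansion *)

Lemma series_dist_le (K : numFieldType) (u : nat -> K) (l B : K) (T : nat) :
  series_converges_to u l ->
  (forall n, (T <= n)%N -> `|series u n - series u T| <= B) ->
  `|l - series u T| <= B.
Proof.
move=> ul uB; apply/ler_addgt0Pr => e e0.
move/cvgrPdist_lt: ul => /(_ e e0) [M _ MP].
have /= := MP (maxn M T) (leq_maxl _ _).
set n := maxn M T => ln.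
rewrite -(subrK (series u n) l) -addrA (le_trans (ler_normD _ _)) // [leRHS]addrC.
by rewrite lerD ?uB ?leq_maxr // ltW.
Qed.

(** [V] stands for an upper bound of [1 / (1 - q)]. *)
Lemma geometric_sum_le (K : numFieldType) (q V : K) (m n : nat) :
  0 <= q -> q < 1 -> 1 <= (1 - q) * V -> (m <= n)%N ->
  \sum_(m <= k < n) q ^+ k <= q ^+ m * V.
Proof.
move=> q0 q1 qV mn; set S := \sum_(m <= k < n) _.
have S0 : 0 <= S by apply: sumr_ge0 => k _; exact: exprn_ge0.
have SE : S * (1 - q) = q ^+ m - q ^+ n.
  rewrite /S mulr_suml (eq_bigr (fun k => - (q ^+ k.+1 - q ^+ k))); last first.
    by move=> k _; rewrite exprSr; ring.
  by rewrite sumrN telescope_sumr // opprB.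
have V0 : 0 <= V.
  rewrite -(pmulr_rge0 _ (_ : 0 < 1 - q)) ?subr_gt0 //.
  exact: le_trans ler01 qV.
apply: (@le_trans _ _ (S * ((1 - q) * V))).
  by rewrite -[leLHS]mulr1 ler_wpM2l.
by rewrite mulrA SE ler_wpM2r // gerBl exprn_ge0.
Qed.

(** Coefficients of [1 - X] times the generating series of [a]; they vanish wherever [a] repeats its
    previous value. *)
Definition diff_digit (V : zmodType) (a : nat -> V) (j : nat) : V :=
  if j is i.+1 then a i.+1 - a i else a 0%N.

Lemma sum_diff_digit (K : comNzRingType) (a : nat -> K) b N :
  \sum_(j < N.+1) diff_digit a j * b ^+ j =
  (1 - b) * (\sum_(j < N.+1) a j * b ^+ j) + a N * b ^+ N.+1.
Proof.
elim: N => [|N IH]; first by rewrite !big_ord1 /= expr0 expr1; ring.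
rewrite big_ord_recr IH [in RHS]big_ord_recr /= !exprS; ring.
Qed.

(** The error has two sources: the tail of the expansion, giving [H * V], and the boundary term of
    [sum_diff_digit], giving 1. *)
Lemma expansion_trunc (beta xi : algC) (r N : nat) (t : int -> algC)
    (M V H : algC) :
  1 < `|beta| -> `|beta - 1| <= H -> 1 <= (1 - `|beta^-1|) * V ->
  (forall n : int, 1 - r%:Z <= n -> `|t n| <= M) ->
  is_expansion beta xi r t ->
  `|\sum_(j < N.+1) diff_digit (fun k => t (1 - r%:Z + k%:Z)) j * beta^-1 ^+ j
     - (beta - 1) * xi * beta^-1 ^+ r| <= `|beta^-1| ^+ N * (M * (H * V + 1)).
Proof.
move=> b1 bH bV tM; rewrite /is_expansion; set u := fun k : nat => _ => ul.
have b0 : beta != 0 by rewrite -normr_gt0 (lt_trans _ b1).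
set b := beta^-1 in bV *; set q := `|b| in bV *.
have q0 : 0 <= q by exact: normr_ge0.
have q1 : q < 1 by rewrite /q /b normfV invf_lt1 ?(lt_trans ltr01 b1).
pose a (k : nat) := t (1 - r%:Z + k%:Z).
have aM k : `|a k| <= M by rewrite tM // lerDl.
have M0 : 0 <= M by exact: le_trans (aM 0%N).
have H0 : 0 <= H by exact: le_trans bH.
have V0 : 0 <= V.
  rewrite -(pmulr_rge0 _ (_ : 0 < 1 - q)) ?subr_gt0 //.
  exact: le_trans ler01 bV.
have bb k : beta ^+ k * b ^+ k = 1 by rewrite -exprMn divff // expr1n.
have uE k : u k = a k * (beta ^+ r * b ^+ k.+1).
  rewrite /u; congr (_ * _).
  have -> : - (1 - r%:Z + k%:Z) = r%:Z + - k.+1%:Z.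
    by rewrite -addn1 PoszD; ring.
  by rewrite expfzDr // -exprnP exprVn exprnN.
have tail : `|xi - series u N.+1| <= M * `|beta| ^+ r * (q ^+ N.+2 * V).
  apply: (series_dist_le ul) => n Nn.
  rewrite sub_series_geq // (le_trans (ler_norm_sum _ _ _)) //.
  apply: (@le_trans _ _ (\sum_(N.+1 <= k < n) M * `|beta| ^+ r * (q * q ^+ k))).
    apply: ler_sum => k _; rewrite uE !normrM !normrX -mulrA -exprS.
    by rewrite ler_wpM2r // mulr_ge0 // exprn_ge0.
  rewrite -!mulr_sumr ler_wpM2l ?mulr_ge0 ?exprn_ge0 //.
  by rewrite exprS -mulrA ler_wpM2l // geometric_sum_le.
rewrite sum_diff_digit -/a.
(* Here [1 - b = (beta - 1) * b], and [b ^+ r] cancels the factor [beta ^+ r] of [u k]. *)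
have -> : (1 - b) * (\sum_(j < N.+1) a j * b ^+ j) =
    (beta - 1) * b ^+ r * series u N.+1.
  rewrite /series /= big_mkord !mulr_sumr; apply: eq_bigr => k _.
  rewrite uE exprS; transitivity ((beta ^+ r * b ^+ r) * ((beta * b - b) * (a k * b ^+ k))).
    by rewrite bb mul1r divff.
  ring.
have regroup (c x y z s : algC) :
    c * z * s + y - c * x * z = y - c * z * (x - s) by ring.
rewrite regroup.
rewrite (le_trans (ler_normB _ _)) // [M * _]mulrDr mulr1 [leRHS]mulrDr [leRHS]addrC.
have qN k : q ^+ (N + k) <= q ^+ N by rewrite ler_wiXn2l ?leq_addr // ltW.
apply: lerD.
  rewrite normrM normrX mulrC; apply: ler_pM (aM N); rewrite ?exprn_ge0 //.
  by rewrite -addn1; exact: qN.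
rewrite !normrM normrX -/q.
apply: (@le_trans _ _ (H * q ^+ r * (M * `|beta| ^+ r * (q ^+ (N + 2) * V)))).
  rewrite addn2 ler_pM ?mulr_ge0 ?exprn_ge0 // ler_wpM2r ?exprn_ge0 //.
have regroup' (h x m y z v : algC) :
    h * x * (m * y * (z * v)) = (y * x) * (z * (m * (h * v))) by ring.
rewrite regroup'.
rewrite -exprMn -normrM divff // normr1 expr1n mul1r ler_wpM2r //.
by rewrite !mulr_ge0.
Qed.

(** * Bounds depending on the height of the data *)

(** One number bounds both the degree and the length of a polynomial, so that all constants below
    depend on [H] alone. *)
Definition height_le (H : nat) (p : {poly int}) : Prop :=
  (size p <= H)%N /\ (\sum_(i < size p) `|(p`_i)%R| <= H)%N.

Lemma norm1_intr (p : {poly int}) :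
  norm1 (map_poly intr p : {poly algC}) = (\sum_(i < size p) `|(p`_i)%R|)%N%:R.
Proof.
have mps : (size (map_poly intr p : {poly algC}) <= size p)%N by exact: size_poly.
rewrite (norm1_wide mps) natr_sum; apply: eq_bigr => i _.
by rewrite coef_map /= -intr_norm -abszE.
Qed.

Lemma zeval_le1 H p z : height_le H p -> `|z| <= 1 -> `|zeval p z| <= H%:R.
Proof.
move=> [_ pH] z1; rewrite (le_trans (norm_horner_le1 _ z1)) //.
by rewrite norm1_intr ler_nat.
Qed.

Lemma zeval_ge1 H p z : height_le H p -> 1 <= `|z| -> `|z| <= H%:R ->
  `|zeval p z| <= (H * H ^ H)%:R.
Proof.
move=> [ps pH] z1 zH.
have mps : (size (map_poly intr p : {poly algC}) <= H)%N.
  by rewrite (leq_trans (size_poly _ _)).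
rewrite (le_trans (norm_horner_ge1 z1 mps)) // natrM natrX norm1_intr.
by rewrite ler_pM ?exprn_ge0 ?ler_nat // lerXn2r ?nnegrE.
Qed.

(** The leading coefficient is a nonzero integer, so the top power of [|z|] is at most [H] times the
    preceding one. *)
Lemma cauchy_bound H p z :
  p != 0 -> height_le H p -> zeval p z = 0 -> 1 < `|z| -> `|z| <= H%:R.
Proof.
move=> p0 [_ pH] pz z1; have z0 : 0 < `|z| by exact: lt_trans z1.
have : (0 < size p)%N by rewrite size_poly_gt0.
case sp : (size p) => [//|n] _.
pose c i : algC := (p`_i)%:~R.
have : \sum_(i < n.+1) c i * z ^+ i = 0.
  have mps : (size (map_poly intr p : {poly algC}) <= size p)%N by exact: size_poly.
  rewrite -[RHS]pz /zeval (horner_coef_wide _ mps) sp.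
  by apply: eq_bigr => i _; rewrite coef_map.
rewrite big_ord_recr /= => /eqP; rewrite addrC addr_eq0 => /eqP cn.
have cn1 : 1 <= `|c n|.
  apply: norm_int_ge1; rewrite intr_eq0.
  have : lead_coef p != 0 by rewrite lead_coef_eq0.
  by rewrite lead_coefE sp.
have cH : \sum_(i < n) `|c i| <= H%:R.
  apply: (@le_trans _ _ (\sum_(i < n.+1) `|c i|)).
    by rewrite big_ord_recr /= lerDl.
  rewrite (eq_bigr (fun i : 'I_n.+1 => (`|(p`_i)%R|%N)%:R)); last first.
    by move=> i _; rewrite /c -intr_norm -abszE.
  by rewrite -natr_sum ler_nat -sp.
(* A nonzero constant has no root. *)
case: n sp cn cn1 cH => [|n] sp cn cn1 cH.
  by move: cn cn1; rewrite big_ord0 expr0 mulr1 oppr0 => ->; rewrite normr0 ler10.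
have : `|c n.+1 * z ^+ n.+1| <= H%:R * `|z| ^+ n.
  rewrite cn normrN (le_trans (ler_norm_sum _ _ _)) //.
  apply: (@le_trans _ _ ((\sum_(i < n.+1) `|c i|) * `|z| ^+ n)).
    rewrite mulr_suml; apply: ler_sum => i _; rewrite normrM normrX ler_wpM2l //.
    by rewrite ler_weXn2l ?ltW // -ltnS.
  by rewrite ler_wpM2r // exprn_ge0.
rewrite normrM normrX exprS mulrA ler_pM2r ?exprn_gt0 // => h.
by rewrite (le_trans _ h) // ler_peMl // ltW.
Qed.

Lemma size_minCpoly_le p z : p != 0 -> zeval p z = 0 ->
  (size (minCpoly z) <= size p)%N.
Proof.
move=> p0 pz; have [q [-> _] qP] := minCpolyP z.
rewrite size_map_poly.
have : root (map_poly ratr (map_poly intr p : {poly rat})) z.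
  rewrite /root -map_poly_comp -[X in _ == X]pz; apply/eqP; congr _.[_].
  by apply: eq_map_poly => k /=; rewrite ratr_int.
rewrite qP => /dvdp_leq; rewrite size_map_inj_poly //; last exact: intr_inj.
apply; rewrite map_poly_eq0_id0 //.
by rewrite intr_eq0 lead_coef_eq0.
Qed.

(* A natural number [V] with [1 / V <= 1 - 1 / |beta|]; see [norm_inv_gap]. *)
Definition inv_gap (H : nat) := (H * (H + 1) * (H ^ 2 + 1) ^ (H * H))%N.

(** [norm_gap] bounds [|beta|^2 - 1 = (1 - 1/|beta|) |beta| (|beta| + 1)] from below, and
    [|beta| <= H] by [cauchy_bound]. *)
Lemma norm_inv_gap H p beta :
  beta \in Aint -> 1 < `|beta| ->
  (forall z, conjugates_over_Q beta z -> z != beta -> z != beta^* -> `|z| <= 1) ->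
  p != 0 -> height_le H p -> zeval p beta = 0 ->
  1 <= (1 - `|beta^-1|) * (inv_gap H)%:R.
Proof.
move=> bA b1 bz p0 pH pb; have bH := cauchy_bound p0 pH pb b1.
have b0 : 0 < `|beta| by exact: lt_trans b1.
have /(norm_gap bA b1 bH) gap : forall z, conjugates_over_Q beta z -> `|z| <= `|beta|.
  move=> z zb; have [->//|zb1] := eqVneq z beta.
  have [->|zb2] := eqVneq z beta^*; first by rewrite norm_conjC.
  by rewrite (le_trans (bz z zb zb1 zb2)) // ltW.
have {}gap := gap H _.
have /gap {}gap : (size (minCpoly beta) <= H.+1)%N.
  by rewrite (leq_trans (size_minCpoly_le p0 pb)) // leqW // pH.1.
apply: le_trans gap _.
have -> : `|beta| ^+ 2 - 1 = (1 - `|beta^-1|) * (`|beta| * (`|beta| + 1)).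
  rewrite normfV; transitivity (`|beta| * (`|beta| + 1) - (`|beta|^-1 * `|beta|) * (`|beta| + 1)).
    rewrite mulVf ?gt_eqF //; ring.
  ring.
rewrite -mulrA ler_wpM2l //; first by rewrite subr_ge0 normfV invf_le1 // ltW.
rewrite /inv_gap natrM natrX ler_wpM2r ?exprn_ge0 //.
by rewrite natrM natrD ler_pM // ?lerD2r // addr_ge0.
Qed.

(** Bernoulli's inequality, together with [|beta| - 1 >= 1 - 1/|beta|]. *)
Lemma norm_pow_ge2 H (beta : algC) : 1 < `|beta| ->
  1 <= (1 - `|beta^-1|) * (inv_gap H)%:R -> 2 <= `|beta| ^+ inv_gap H.
Proof.
move=> b1 h; have b0 : 0 < `|beta| by exact: lt_trans b1.
have bern (x : algC) n : 0 <= x -> 1 + x * n%:R <= (1 + x) ^+ n.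
  move=> x0; elim: n => [|n IH]; first by rewrite mulr0 addr0 expr0.
  have x1 : 0 <= 1 + x by rewrite addr_ge0.
  rewrite exprS (le_trans _ (ler_wpM2l x1 IH)) // -natr1 -subr_ge0.
  rewrite [leRHS](_ : _ = x * x * n%:R); last by ring.
  by rewrite !mulr_ge0.
have : 1 + (`|beta| - 1) * (inv_gap H)%:R <= `|beta| ^+ inv_gap H.
  by rewrite -[X in X ^+ _](subrKC 1) bern // subr_ge0 ltW.
apply: le_trans; rewrite -[2]/(1 + 1) lerD2l (le_trans h) //.
rewrite ler_wpM2r // normfV -subr_ge0.
have -> : `|beta| - 1 - (1 - `|beta|^-1) = (`|beta| - 1) ^+ 2 * `|beta|^-1.
  rewrite expr2 [RHS](_ : _ = `|beta| * (`|beta|^-1 * `|beta|) - 2 * (`|beta|^-1 * `|beta|) + `|beta|^-1); last by ring.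
  by rewrite mulVf ?gt_eqF //; ring.
by rewrite mulr_ge0 ?invr_ge0 // exprn_ge0 // subr_ge0 ltW.
Qed.

Lemma zeval_diff_digit (tau : nat -> {poly int}) z j :
  zeval (diff_digit tau j) z = diff_digit (fun k => zeval (tau k) z) j.
Proof. by case: j => //= j; rewrite !zevalE rmorphB. Qed.

Lemma map_digit_poly (tau : nat -> {poly int}) N z :
  map_poly (zevalr z) (\poly_(j < N) diff_digit tau j) =
  \poly_(j < N) diff_digit (fun k => zeval (tau k) z) j.
Proof.
apply/polyP => i; rewrite coef_map !coef_poly.
by case: ifP => _; [exact: zeval_diff_digit|exact: (rmorph0 (zevalr z))].
Qed.

Lemma norm_diff_digit (K : numDomainType) (a : nat -> K) M j :
  (forall k, `|a k| <= M) -> `|diff_digit a j| <= M * 2.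
Proof.
move=> aM; have M0 : 0 <= M by exact: le_trans (aM 0%N).
case: j => [|j] /=; first by rewrite (le_trans (aM _)) // ler_peMr // ler1n.
by rewrite (le_trans (ler_normB _ _)) // mulr_natr mulr2n lerD.
Qed.

Lemma norm1_digit_poly (K : numDomainType) (a : nat -> K) M N :
  (forall k, `|a k| <= M) ->
  norm1 (\poly_(j < N) diff_digit a j) <= M * 2 * N%:R.
Proof.
move=> aM; rewrite (norm1_wide (size_poly _ _)) mulrC natr_mul_sum.
apply: ler_sum => i _; rewrite coef_poly ltn_ord; exact: norm_diff_digit.
Qed.

(* Under the hypotheses of [no_gap], with all data of height at most [H] and
   [eta := (beta - 1) * xi * beta^-r]: [digit_bound] bounds the values at [beta]
   of the digits; [eta_bound * N.+1] bounds [eta] and the norm of the digit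
   polynomial; [coef_bound] bounds the coefficients of the relation between the
   powers of [eta]; [conj_bound * N.+1 ^ H] bounds the conjugates of the
   truncated relation other than itself and its complex conjugate; a gap of
   length [g] would force [|beta|^g <= norm_ratio * N.+1 ^ gap_exponent]; and
   [gap_factor * l] is longer than any gap as soon as [N < 2^l]. *)
Definition digit_bound (H : nat) := (H * H ^ H)%N.
Definition eta_bound (H : nat) := (digit_bound H * (2 * H * inv_gap H + 3))%N.
Definition coef_bound (H : nat) := ((2 * H) ^ H * digit_bound H * H ^ (H * H))%N.
Definition conj_bound (H : nat) := ((H + 1) * (2 ^ H * H * (2 * H) ^ H))%N.
Definition gap_exponent (H : nat) := (H + 1 + H * H)%N.
Definition norm_ratio (H : nat) :=
  ((H + 1) * (coef_bound H * ((H + 1) * eta_bound H ^ (H + 1))) * conj_bound H ^ H)%N.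
Definition gap_factor (H : nat) := (inv_gap H * (norm_ratio H + gap_exponent H))%N.

(** With [M = digit_bound H] and [x = 2 * H * inv_gap H], the right-hand side is
    [eta_bound H * n.+1]. The left-hand sides bound the truncation error, the digit polynomial, and
    their sum, hence [eta]. *)
Lemma const_bounds (M x n : nat) :
  [/\ (M * x.+1 <= M * (x + 3) * n.+1)%N,
      (M * 2 * n.+1 <= M * (x + 3) * n.+1)%N
    & (M * x.+1 + M * 2 * n.+1 <= M * (x + 3) * n.+1)%N].
Proof. by split; nia. Qed.

(** Used in [no_gap] to gather the powers of [N.+1]: [H + 1] from the upper bound of the truncated
    relation and [H * H] from its conjugates. *)
Lemma collect_powers (D H C z u n : nat) :
  (D <= H)%N -> (0 < z)%N ->
  (D.+1 * (C * (D.+1 * (z * n.+1) ^ D.+1)) * (u * n.+1 ^ H) ^ H <=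
   (H + 1) * (C * ((H + 1) * z ^ (H + 1))) * u ^ H * n.+1 ^ (H + 1 + H * H))%N.
Proof.
move=> DH z0.
apply: (@leq_trans ((H + 1) * (C * ((H + 1) * (z * n.+1) ^ (H + 1))) *
    (u * n.+1 ^ H) ^ H)).
  by rewrite !leq_mul ?addn1 // leq_pexp2l ?muln_gt0 ?z0.
apply: eq_leq; rewrite [(n.+1 ^ (H + 1 + _))%N]expnD [(n.+1 ^ (H * H))%N]expnM.
rewrite !expnMn; move: (n.+1 ^ (H + 1))%N ((n.+1 ^ H) ^ H)%N (u ^ H)%N => x y w.
by move: (z ^ (H + 1))%N => v; ring.
Qed.

Lemma no_gap (H D r R N l : nat) (beta xi pi : algC) (p : {poly int})
    (a tau : nat -> {poly int}) (t : int -> algC)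
    (P := \poly_(j < N.+1) diff_digit tau j) :
  beta \in Aint -> 1 < `|beta| ->
  (forall z, conjugates_over_Q beta z -> z != beta -> z != beta^* -> `|z| <= 1) ->
  p != 0 -> height_le H p -> zeval p beta = 0 ->
  (D <= H)%N -> (r <= H)%N -> (0 < R)%N -> (0 < l)%N -> (N.+1 <= 2 ^ l)%N ->
  (forall k, (k <= D)%N -> height_le H (a k)) ->
  (forall k, height_le H (tau k)) ->
  (forall k : nat, t (1 - r%:Z + k%:Z) = zeval (tau k) beta) ->
  is_expansion beta xi r t ->
  \sum_(k < D.+1) zeval (a k) beta * xi ^+ k = 0 ->
  pi != 0 ->
  (forall k, (1 <= k <= D)%N ->
     in_Zadj beta ((beta - 1) ^+ (D - k) * zeval (a k) beta / pi)) ->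
  (forall n, (0 < n)%N ->
     ~ in_Zadj beta ((beta - 1) ^+ D * beta ^+ n * zeval (a 0%N) beta / pi)) ->
  (R + gap_factor H * l <= N)%N ->
  (forall k m, (1 <= k <= D)%N -> (R < m <= R + gap_factor H * l)%N ->
     (map_poly (zevalr beta) P ^+ k)`_m = 0) ->
  False.
Proof.
move=> bA b1 bz p0 pH pb DH rH R0 l0 Nl aH tauH tE ex rel pi0 aP a0 RgN gap.
set g := (gap_factor H * l)%N in RgN gap.
have bH := cauchy_bound p0 pH pb b1.
have bV := norm_inv_gap bA b1 bz p0 pH pb.
have b0 : beta != 0 by rewrite -normr_gt0 (lt_trans _ b1).
have H1 : (1 <= H)%N by rewrite -(ler_nat algC) ltW // (lt_le_trans b1).
have HC1 : 1 <= H%:R :> algC by rewrite ler1n.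
have b1H : `|beta - 1| <= (2 * H)%:R.
  rewrite (le_trans (ler_normB _ _)) // normr1 mulnC muln2 -addnn natrD.
  by rewrite lerD.
have M0 : 0 <= (digit_bound H)%:R :> algC by [].
have tauM k : `|zeval (tau k) beta| <= (digit_bound H)%:R.
  exact: zeval_ge1 (tauH k) (ltW b1) bH.
have tM (n : int) : 1 - r%:Z <= n -> `|t n| <= (digit_bound H)%:R.
  move=> rn; pose d : int := n - (1 - r%:Z); have -> : n = 1 - r%:Z + (absz d)%:Z.
    by rewrite gez0_abs ?subr_ge0 // /d; ring.
  by rewrite tE tauM.
pose eta := (beta - 1) * xi * beta^-1 ^+ r.
pose Z : algC := (eta_bound H * N.+1)%:R.
have pE := map_digit_poly tau N.+1 beta.
have PE : (map_poly (zevalr beta) P).[beta^-1] =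
   \sum_(j < N.+1) diff_digit (fun k => t (1 - r%:Z + k%:Z)) j * beta^-1 ^+ j.
  rewrite pE horner_poly; apply: eq_bigr => j _; congr (_ * _).
  by case: (j : nat) => [|i] /=; rewrite !tE.
have Pe0 := expansion_trunc N b1 b1H bV tM ex.
rewrite -PE -/eta in Pe0.
have q1 : `|beta^-1| <= 1 by rewrite normfV invf_le1 ?(ltW b1) // (lt_trans _ b1).
have epsZ : (digit_bound H)%:R * ((2 * H)%:R * (inv_gap H)%:R + 1) <= Z :> algC.
  by rewrite -natrM natr1 -natrM ler_nat /eta_bound; case: (const_bounds (digit_bound H) (2 * H * inv_gap H) N).
have PZ1 : norm1 (map_poly (zevalr beta) P) <= (digit_bound H)%:R * 2 * N.+1%:R.
  rewrite pE; exact: norm1_digit_poly.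
have PZ : norm1 (map_poly (zevalr beta) P) <= Z.
  by rewrite (le_trans PZ1) // -!natrM ler_nat /eta_bound; case: (const_bounds (digit_bound H) (2 * H * inv_gap H) N).
have etaZ : `|eta| <= Z.
  rewrite -(subrK (map_poly (zevalr beta) P).[beta^-1] eta).
  rewrite (le_trans (ler_normD _ _)) // distrC.
  rewrite (le_trans (lerD Pe0 (le_trans (norm_horner_le1 _ q1) PZ1))) //.
  apply: (@le_trans _ _ ((digit_bound H)%:R * ((2 * H)%:R * (inv_gap H)%:R + 1) + (digit_bound H)%:R * 2 * N.+1%:R)).
    by rewrite lerD2r ler_piMl ?exprn_ile1 // mulr_ge0 // addr_ge0 // mulr_ge0.
  by rewrite -natrM natr1 -!natrM -natrD ler_nat /eta_bound; case: (const_bounds (digit_bound H) (2 * H * inv_gap H) N).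
have V1 : (1 <= inv_gap H)%N by rewrite !muln_gt0 H1 addn1 /= expn_gt0 addn1.
have Mc1 : (1 <= digit_bound H)%N by rewrite muln_gt0 H1 expn_gt0 H1.
have Z1 : 1 <= Z.
  by rewrite ler1n muln_gt0 muln_gt0 Mc1 addn3.
have C0 : 0 <= (coef_bound H)%:R :> algC by [].
have cC k : (k <= D)%N ->
    `|(beta - 1) ^+ (D - k) * zeval (a k) beta * beta ^+ (r * k)| <= (coef_bound H)%:R.
  move=> kD; rewrite !normrM !normrX /coef_bound natrM natrM.
  apply: ler_pM; rewrite ?mulr_ge0 ?exprn_ge0 //.
    apply: ler_pM; rewrite ?exprn_ge0 //; last exact: zeval_ge1 (aH k kD) (ltW b1) bH.
    rewrite natrX (@le_trans _ _ ((2 * H)%:R ^+ (D - k))) //.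
      by rewrite lerXn2r ?nnegrE.
    apply: ler_weXn2l; first by rewrite ler1n muln_gt0.
    exact: leq_trans (leq_subr _ _) DH.
  rewrite natrX (@le_trans _ _ (H%:R ^+ (r * k))) //.
    by rewrite lerXn2r ?nnegrE.
  by rewrite ler_weXn2l // leq_mul // (leq_trans kD).
(* The relation for [xi] times [(beta - 1) ^+ D]; the factor [beta ^+ (r * k)] undoes the shift by
   [beta^-1 ^+ r] in [eta]. *)
have rel' : \sum_(k < D.+1) (beta - 1) ^+ (D - k) * zeval (a k) beta *
    beta ^+ (r * k) * eta ^+ k = 0.
  transitivity ((beta - 1) ^+ D * \sum_(k < D.+1) zeval (a k) beta * xi ^+ k).
    rewrite mulr_sumr; apply: eq_bigr => k _.
  have kD : (k <= D)%N by rewrite -ltnS.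
  have -> : (beta - 1) ^+ D = (beta - 1) ^+ (D - k) * (beta - 1) ^+ k.
    by rewrite -exprD subnK.
  rewrite /eta !exprMn -exprM.
  have : beta ^+ (r * k) * beta^-1 ^+ (r * k) = 1.
    by rewrite -exprMn divff // expr1n.
  have regroup (u v x y z w : algC) : x * y = 1 ->
     u * v * x * (z * w * y) = u * z * (v * w).
    by move=> xy; transitivity (u * z * (v * w) * (x * y)); [ring|rewrite xy mulr1].
  exact: regroup.
  by rewrite rel mulr0.
have Pe : `|(map_poly (zevalr beta) P).[beta^-1] - eta| <= `|beta^-1| ^+ N * Z.
  by rewrite (le_trans Pe0) // ler_wpM2l // exprn_ge0.
have upper := norm_trunc_rel_gap b1 Z1 C0 cC rel' PZ etaZ Pe RgN gap.
have W0 := @trunc_rel_neq0 D r R beta pi a P R0 pi0 aP a0.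
pose U : algC := (conj_bound H * N.+1 ^ H)%:R.
have U1 : 1 <= U.
  by rewrite ler1n !muln_gt0 !expn_gt0 muln_gt0 H1 addn1.
have sm : (size (minCpoly beta) <= H.+1)%N.
  by rewrite (leq_trans (size_minCpoly_le p0 pb)) // leqW // pH.1.
have WU z : conjugates_over_Q beta z -> z != beta -> z != beta^* ->
    `|zeval (trunc_rel D r R a P) z| <= U.
  move=> zb zb1 zb2; have z1 := bz z zb zb1 zb2.
  pose L : algC := (2 * H * N.+1)%:R.
  have L1 : 1 <= L by rewrite ler1n !muln_gt0 H1.
  rewrite (le_trans (@norm_trunc_rel_conj D r R a P z H%:R L z1 L1 _ _ _)) //.
  - by move=> k kD; exact: zeval_le1 (aH k kD) z1.
  - rewrite map_digit_poly (le_trans (norm1_digit_poly (M := H%:R) _ _)) //.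
      by move=> k; exact: zeval_le1 (tauH k) z1.
    by rewrite -!natrM [(H * 2)%N]mulnC.
  - rewrite -natrX -natrM -natrX -!natrM ler_nat /conj_bound.
    rewrite expnMn -!mulnA leq_mul //; first by rewrite addn1.
    by rewrite !leq_mul // leq_pexp2l ?muln_gt0 ?H1.
have lower := zeval_lower_bound bA W0 U1 sm WU.
set w := `|zeval _ beta| in upper lower.
(* Insert the upper bound of [w] into the lower bound [1 <= w * U ^+ H], multiplied by
   [|beta| ^+ g]. *)
have : `|beta| ^+ g <= (norm_ratio H * N.+1 ^ gap_exponent H)%:R.
  apply: (@le_trans _ _ (`|beta| ^+ g * (w * U ^+ H))).
    by rewrite ler_peMr // exprn_ge0.
  apply: (@le_trans _ _ (`|beta| ^+ g * (D.+1%:R * ((coef_bound H)%:R * (D.+1%:R * Z ^+ D.+1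
      * `|beta^-1| ^+ g)) * U ^+ H))).
    apply: ler_wpM2l; first by rewrite exprn_ge0.
    by apply: ler_wpM2r upper; rewrite exprn_ge0.
  have bb : `|beta| ^+ g * `|beta^-1| ^+ g = 1.
    by rewrite -exprMn -normrM divff // normr1 expr1n.
  have regroup (x d c z y u : algC) : x * y = 1 ->
     x * (d * (c * (d * z * y)) * u) = d * (c * (d * z)) * u.
    by move=> xy; transitivity (d * (c * (d * z)) * u * (x * y)); [ring|rewrite xy mulr1].
  rewrite regroup // -!natrX -!natrM ler_nat /norm_ratio /gap_exponent.
  by apply: collect_powers; rewrite // muln_gt0 Mc1 addn3.
(* Conversely [2 <= |beta| ^+ inv_gap H] gives [|beta| ^+ g >= 2 ^ ((x + y) * l)] with
   [x = norm_ratio H] and [y = gap_exponent H], which exceeds [x * N.+1 ^ y] because [x < 2 ^ x] and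
   [N.+1 <= 2 ^ l]. *)
apply/negP; rewrite real_leNgt ?ger0_real ?exprn_ge0 // negbK.
apply: (@lt_le_trans _ _ (2 ^+ ((norm_ratio H + gap_exponent H) * l))); last first.
  rewrite /g /gap_factor -mulnA [`|beta| ^+ _]exprM lerXn2r ?nnegrE ?exprn_ge0 //.
  exact: norm_pow_ge2.
rewrite -natrX ltr_nat; move: (norm_ratio H) (gap_exponent H) => x y.
rewrite mulnDl expnD; apply: (@leq_trans (2 ^ x * (2 ^ l) ^ y)).
  apply: (@leq_trans (2 ^ x * N.+1 ^ y)).
    by rewrite ltn_pmul2r ?expn_gt0 // ltn_expl.
  by rewrite leq_pmul2l ?expn_gt0 //; case: y => // y; rewrite leq_exp2r.
by rewrite -expnM [(l * y)%N]mulnC leq_mul2r leq_pexp2l ?orbT // leq_pmulr.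
Qed.

(** * Counting digit changes *)

(** A nonzero digit at a position [i > r] is a change between [t_(i-r)] and [t_(i-r+1)]; the
    positions [0, ..., r] account for [r.+1]. *)
Lemma size_supp_digits (t : int -> algC) (r N : nat) :
  (size (supp (\poly_(j < N.+1) diff_digit (fun k : nat => t (1 - r%:Z + k%:Z)%R) j)%R)
    <= num_changes t N + r.+1)%N.
Proof.
pose ch (n : nat) := t n%:Z != t n.+1%:Z.
have -> : num_changes t N = size [seq n <- iota 1 N | ch n].
  by rewrite size_filter -sum1_count big_mkcond /num_changes /index_iota subSS subn0.
set s := [seq n <- _ | _].
apply: (@leq_trans (size ([seq (n + r)%N | n <- s] ++ iota 0 r.+1))); last first.
  by rewrite size_cat size_map size_iota.
apply: uniq_leq_size => [|i]; first by rewrite filter_uniq ?iota_uniq.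
rewrite mem_supp coef_poly mem_cat mem_iota /= add0n.
case: ltnP => [iN|]; last by rewrite eqxx.
have [ir|ri] := ltnP i r.+1; first by rewrite orbT.
rewrite orbF => ti; apply/mapP; exists (i - r)%N; last by lia.
rewrite mem_filter mem_iota /ch; apply/andP; split; last by lia.
case: i ri iN ti => [|i] ri iN //=.
rewrite subr_eq0 eq_sym.
have -> : 1 - r%:Z + i.+1%:Z = (i.+1 - r).+1%:Z by lia.
by have -> : 1 - r%:Z + i%:Z = (i.+1 - r)%:Z by lia.
Qed.

Lemma size_flatten_supp_le (K : nzRingType) (p : {poly K}) (D L : nat) :
  (size (supp p) <= L.+1)%N ->
  (size (flatten [seq supp (p ^+ k)%R | k <- iota 1 D]) <= D * L.+1 ^ D)%N.
Proof.
move=> pL; rewrite size_flatten sumnE /shape !big_map.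
apply: (@leq_trans (\sum_(k <- iota 1 D) L.+1 ^ D)); last first.
  by rewrite big_const_seq count_predT size_iota iter_addn_0 mulnC.
rewrite big_seq [leqRHS]big_seq; apply: leq_sum => k; rewrite mem_iota => /andP[_ kD].
rewrite (leq_trans (size_suppX _ _)) //.
apply: (@leq_trans (L.+1 ^ k)); first by case: (k) => // ?; rewrite leq_exp2r.
by rewrite leq_pexp2l.
Qed.

Lemma count_bound (H D r N l : nat) (beta xi pi : algC) (p : {poly int})
    (a tau : nat -> {poly int}) (t : int -> algC) :
  beta \in Aint -> 1 < `|beta| ->
  (forall z, conjugates_over_Q beta z -> z != beta -> z != beta^* -> `|z| <= 1) ->
  p != 0 -> height_le H p -> zeval p beta = 0 ->
  (D <= H)%N -> (r <= H)%N -> (0 < l)%N -> (N.+1 <= 2 ^ l)%N ->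
  (forall k, (k <= D)%N -> height_le H (a k)) ->
  (forall k, height_le H (tau k)) ->
  (forall k : nat, t (1 - r%:Z + k%:Z) = zeval (tau k) beta) ->
  is_expansion beta xi r t ->
  \sum_(k < D.+1) zeval (a k) beta * xi ^+ k = 0 ->
  pi != 0 ->
  (forall k, (1 <= k <= D)%N ->
     in_Zadj beta ((beta - 1) ^+ (D - k) * zeval (a k) beta / pi)) ->
  (forall n, (0 < n)%N ->
     ~ in_Zadj beta ((beta - 1) ^+ D * beta ^+ n * zeval (a 0%N) beta / pi)) ->
  (N < gap_factor H * l * ((H + 2) * (num_changes t N + H + 1) ^ D))%N.
Proof.
move=> bA b1 bz p0 pH pb DH rH l0 Nl aH tauH tE ex rel pi0 aP a0.
have bH := cauchy_bound p0 pH pb b1.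
have H1 : (1 <= H)%N by rewrite -(ler_nat algC) ltW // (lt_le_trans b1).
pose P := \poly_(j < N.+1) diff_digit tau j.
pose p' := map_poly (zevalr beta) P.
pose L := (num_changes t N + H)%N.
have pL : (size (supp p') <= L.+1)%N.
  have -> : p' = \poly_(j < N.+1) diff_digit (fun k : nat => t (1 - r%:Z + k%:Z)) j.
    rewrite /p' map_digit_poly; apply/polyP => j; rewrite !coef_poly.
    by case: ifP => // _; case: j => [|j] /=; rewrite !tE.
  apply: leq_trans (size_supp_digits t r N) _.
  by rewrite /L -addnS leq_add2l ltnS.
pose G := flatten [seq supp (p' ^+ k)%R | k <- iota 1 D].
have GL : (size G <= D * L.+1 ^ D)%N by exact: size_flatten_supp_le.
pose g := (gap_factor H * l)%N.
have g0 : (0 < g)%N.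
  rewrite muln_gt0 l0 andbT /gap_factor muln_gt0; apply/andP; split.
    by rewrite !muln_gt0 H1 addn1 /= expn_gt0 addn1.
  by rewrite /gap_exponent addn1 addSn addnS.
(* Otherwise [ex_gap] yields a window that avoids the supports of all powers [p' ^+ k],
   [1 <= k <= D], against [no_gap]. *)
have Ng : (N %/ g < size G + 2)%N.
  rewrite ltnNge; apply/negP => /(ex_gap g0) [R R0 [RgN gap]].
  apply: (@no_gap H D r R N l beta xi pi p a tau t) => //.
  move=> k m /andP[k1 kD] mR; apply/eqP; have := gap m mR.
  apply: contraR => pm; apply/flatten_mapP; exists k.
    by rewrite mem_iota k1 add1n ltnS.
  by rewrite mem_supp.
move: Ng; rewrite ltn_divLR // => Ng.
apply: leq_trans Ng _; rewrite mulnC leq_mul2l; apply/orP; right.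
rewrite addn1 -/L; have : (1 <= L.+1 ^ D)%N by rewrite expn_gt0.
by move: GL; move: (L.+1 ^ D)%N (size G) => x y; nia.
Qed.

(** The power [(H + 2) ^ H] absorbs [gam + H + 1 <= (H + 2) * gam], valid for [gam >= 1]. *)
Definition count_factor (H : nat) := (gap_factor H * ((H + 2) * (H + 2) ^ H))%N.

Lemma mulnS_le_exp2 m : (m * m.+1 <= 2 * 2 ^ m)%N.
Proof.
elim: m => // m IH; have := ltn_expl m (isT : 1 < 2)%N.
by rewrite expnS; move: (2 ^ m)%N IH => x; nia.
Qed.

(** For [gam = 0] the hypotheses would give [N < count_factor H * l.+1], hence
    [2 * N < l * l.+1 <= 2 * 2 ^ l <= 2 * N]. *)
Lemma count_bound_large (H D N gam l : nat) :
  (D <= H)%N -> (2 ^ l <= N)%N -> (2 * count_factor H <= l)%N ->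
  (N < gap_factor H * l.+1 * ((H + 2) * (gam + H + 1) ^ D))%N ->
  (0 < gam)%N /\ (N < count_factor H * l.+1 * gam ^ D)%N.
Proof.
move=> DH lN Ql; rewrite /count_factor in Ql *; move: (gap_factor H) Ql => K Ql NK.
have e1 x : (0 < x)%N -> (x ^ D <= x ^ H)%N by move=> x0; rewrite leq_pexp2l.
have gam0 : (0 < gam)%N.
  rewrite lt0n; apply/negP => /eqP g0; move: NK; rewrite g0 add0n ltnNge => /negP[].
  apply: leq_trans lN; rewrite -(leq_pmul2l (isT : 0 < 2)%N).
  apply: leq_trans (mulnS_le_exp2 l); rewrite mulnCA.
  have : ((H + 1) ^ D <= (H + 2) ^ H)%N.
    apply: (@leq_trans ((H + 2) ^ D)); last by rewrite e1 // addn2.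
    by case: (D) => // d; rewrite leq_exp2r // leq_add2l.
  move: ((H + 1) ^ D)%N ((H + 2) ^ H)%N Ql => x y Ql xy.
  apply: (@leq_trans (2 * (K * ((H + 2) * y)) * l.+1)); last by rewrite leq_mul2r Ql orbT.
  rewrite [leqRHS](_ : _ = K * (2 * (l.+1 * ((H + 2) * y))))%N; last by ring.
  rewrite [leqLHS](_ : _ = K * (2 * (l.+1 * ((H + 2) * x))))%N; last by ring.
  by rewrite !leq_mul.
split=> //; apply: leq_trans NK _.
rewrite [leqRHS](_ : _ = K * l.+1 * ((H + 2) * ((H + 2) ^ H * gam ^ D)))%N; last by ring.
rewrite !leq_mul //; apply: (@leq_trans (((H + 2) * gam) ^ D)).
  by case: (D) => // d; rewrite leq_exp2r //; nia.
by rewrite expnMn leq_mul // e1 // addn2.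
Qed.

(** The inequality [ln (1 + x) <= x] at [x = -1/2]. *)
Lemma ln2_ge (R : realType) : 2^-1 <= ln 2 :> R.
Proof.
have := @le_ln1Dx R (- 2^-1); rewrite (_ : 1 + - 2^-1 = 2^-1); last by field.
by rewrite lnV ?posrE // lerN2; apply; lra.
Qed.

(** From [l.+1 <= 2 * l <= 4 * ln N] follows [N / ln N <= 4 * Q * gam ^ D]. Take [D]-th roots and
    use that the root of [4 * Q] is at most [4 * Q <= 2 ^ (4 * Q)]. *)
Lemma powR_count_bound (R : realType) (D N gam l Q : nat) :
  (0 < D)%N -> (0 < l)%N -> (2 ^ l <= N)%N -> (0 < Q)%N ->
  (N < Q * l.+1 * gam ^ D)%N ->
  (2 ^+ (4 * Q))^-1 * ((N%:R / ln N%:R) `^ D%:R^-1) <= gam%:R :> R.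
Proof.
move=> D0 l0 lN Q0 NQ.
have N0 : (0 < N)%N by rewrite (leq_trans _ lN) // expn_gt0.
have lnN : l%:R / 2 <= ln (N%:R : R).
  apply: (@le_trans _ _ (ln (2 ^+ l))).
    by rewrite lnXn // -[leRHS]mulr_natl ler_wpM2l ?ler0n ?ln2_ge.
  by rewrite ler_ln ?posrE ?exprn_gt0 ?ltr0n // -natrX ler_nat.
have l1 : (1 : R) <= l%:R by rewrite ler1n.
have lnN0 : 0 < ln (N%:R : R) by rewrite (lt_le_trans _ lnN) // divr_gt0 // ltr0n.
have X0 : 0 <= N%:R / ln N%:R :> R by rewrite divr_ge0 // ltW.
have XQ : N%:R / ln N%:R <= (4 * Q)%:R * gam%:R ^+ D :> R.
  rewrite ler_pdivrMr //; apply: (@le_trans _ _ (Q * l.+1 * gam ^ D)%:R).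
    by rewrite ler_nat ltnW.
  rewrite !natrM natrX -natr1 mulrAC [leRHS](_ : _ = Q%:R * gam%:R ^+ D * (4 * ln N%:R)).
    by rewrite ler_wpM2l ?mulr_ge0 ?exprn_ge0 //; lra.
  by ring.
have Q1 : (1 : R) <= (4 * Q)%:R by rewrite ler1n muln_gt0.
rewrite ler_pdivrMl ?exprn_gt0 //.
apply: (@le_trans _ _ (((4 * Q)%:R * gam%:R ^+ D) `^ D%:R^-1)).
  by apply: ge0_ler_powR; rewrite ?nnegrE ?invr_ge0 // mulr_ge0 // exprn_ge0.
rewrite powRM ?exprn_ge0 // -[gam%:R ^+ D]powR_mulrn // -powRrM.
rewrite divff ?pnatr_eq0 -?lt0n // powRr1 // ler_wpM2r //.
apply: (@le_trans _ _ (4 * Q)%:R).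
  by apply: ler1_powR => //; rewrite invf_le1 ?ler1n ?ltr0n.
by rewrite -natrX ler_nat ltnW // ltn_expl.
Qed.

(** * The theorem *)

Ltac recursive_arith := repeat first
  [ assumption | apply: recursive_const | apply: recursive_mul
  | apply: recursive_add | apply: recursive_exp | exact: rec_proj ].

Lemma recursive_count_factor k (f : k.-tuple nat -> nat) :
  recursive f -> recursive (fun v => count_factor (f v)).
Proof.
move=> rf.
have rV : recursive (fun v => inv_gap (f v)) by rewrite /inv_gap; recursive_arith.
have rM : recursive (fun v => digit_bound (f v)) by rewrite /digit_bound; recursive_arith.
have rz : recursive (fun v => eta_bound (f v)) by rewrite /eta_bound; recursive_arith.
have rC : recursive (fun v => coef_bound (f v)) by rewrite /coef_bound; recursive_arith.
have ru : recursive (fun v => conj_bound (f v)) by rewrite /conj_bound; recursive_arith.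
have rE : recursive (fun v => gap_exponent (f v)) by rewrite /gap_exponent; recursive_arith.
have rK1 : recursive (fun v => norm_ratio (f v)) by rewrite /norm_ratio; recursive_arith.
have rK : recursive (fun v => gap_factor (f v)) by rewrite /gap_factor; recursive_arith.
by rewrite /count_factor; recursive_arith.
Qed.

(** A polynomial of code at most [n] has at most [n] coefficients, each at most [n] in absolute
    value. *)
Definition height_of_code (n : nat) := ((n + 1) ^ 2)%N.

Lemma leq_height_of_code n : (n <= height_of_code n)%N.
Proof. by rewrite /height_of_code addn1; nia. Qed.

Lemma height_le_pickle (p : {poly int}) n :
  (pickle p <= n)%N -> height_le (height_of_code n) p.
Proof.
move=> pn; have sn : (size p <= n)%N by rewrite (leq_trans (pickle_poly_size p)).
split; first by rewrite (leq_trans sn) ?leq_height_of_code.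
apply: (@leq_trans (\sum_(i < size p) n)).
  by apply: leq_sum => i _; rewrite (leq_trans (pickle_poly_coef _ _)).
rewrite sum_nat_const card_ord /height_of_code; nia.
Qed.

Lemma pickle_data_code (c : data_code) :
  let: (cbeta, cxi, cS, cr, cpi, cA) := c in
  [/\ (pickle cbeta.1.1 <= pickle c)%N, (pickle cS <= pickle c)%N,
      (cr <= pickle c)%N & (pickle cA <= pickle c)%N].
Proof.
case: c => [[[[[cb cx] cS] cr] cpi] cA]; set c := (_, cA).
have h5 := pickle_pairl c.
have h4 := leq_trans (pickle_pairl c.1) h5.
have h3 := leq_trans (pickle_pairl c.1.1) h4.
have h2 := leq_trans (pickle_pairl c.1.1.1) h3.
have h1 := leq_trans (pickle_pairl c.1.1.1.1) h2.
have h0 := leq_trans (pickle_pairl c.1.1.1.1.1) h1.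
split.
- exact: leq_trans (pickle_pairl c.1.1.1.1.1.1) h0.
- exact: leq_trans (pickle_pairr c.1.1.1) h3.
- exact: leq_trans (pickle_pairr c.1.1) h4.
- exact: pickle_pairr c.
Qed.

Theorem theorem2p1 (R : realType) :
  exists C5 C6 : data_code -> R,
    effectively_computable C5 /\ effectively_computable C6 /\
    forall (c : data_code) (beta xi : algC) (D : nat) (S : seq algC)
           (r : nat) (t : int -> algC) (pi : algC) (A : nat -> algC),
      quasi_Pisot beta \/ quasi_Salem beta ->
      relative_degree beta xi D ->
      (forall s, s \in S -> in_Zadj beta s) ->
      0 \in S ->
      (~ {subset S <= (Num.int : {pred algC})} ->
         beta \notin Num.real /\
         exists alpha : algC,
           [/\ imaginary_quadratic_integer alpha, in_Qadj beta alpha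
             & forall s, s \in S -> in_ring_of_integers alpha s]) ->
      (forall n : int, 1 - r%:Z <= n -> t n \in S) ->
      is_expansion beta xi r t ->
      in_Zadj beta pi ->
      (forall k, (k <= D)%N -> in_Zadj beta (A k)) ->
      pi != 0 ->
      A D != 0 ->
      \sum_(k < D.+1) A k * xi ^+ k = 0 ->
      (forall k, (1 <= k <= D)%N ->
         in_Zadj beta ((beta - 1) ^+ (D - k) * A k / pi)) ->
      (forall n, (0 < n)%N ->
         ~ in_Zadj beta ((beta - 1) ^+ D * beta ^+ n * A 0%N / pi)) ->
      describes_data c beta xi S r pi D A ->
      [/\ 0 < C5 c, 0 < C6 c
        & forall N : nat, C6 c <= N%:R ->
            C5 c * ((N%:R / ln N%:R) `^ (D%:R^-1)) <= (num_changes t N)%:R].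
Proof.
pose Q (n : nat) := count_factor (height_of_code n).
have rH k (f : k.-tuple nat -> nat) : recursive f -> recursive (fun v => height_of_code (f v)).
  by move=> rf; rewrite /height_of_code; recursive_arith.
have rQ : recursive (fun v : 2.-tuple nat => Q (tnth v ord0)).
  by apply: recursive_count_factor; apply: rH; exact: rec_proj.
(* An inverse power of two is itself dyadic, which makes its computability immediate. *)
exists (fun c => (2 ^+ (4 * Q (pickle c)))^-1).
(* This threshold makes the binary logarithm of [N] at least [2 * Q + 1]: large enough for
   [count_bound_large], and positive. *)
exists (fun c => (2 ^ (2 * Q (pickle c) + 1))%N%:R).
split.
  apply: (@effectively_computable_exp2N R _ (fun n => 4 * Q n)%N).
  by recursive_arith.
split.
  apply: (@effectively_computable_nat R _ (fun n => 2 ^ (2 * Q n + 1))%N).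
  by recursive_arith.
move=> c beta xi D S r t pi A bPS _ _ _ _ tS ex _ _ pi0 AD rel aP a0.
have := pickle_data_code c.
case: c => [[[[[[[p [qa qb]] e] cxi] cS] cr] cpi] cA]; set c := (_, cA).
move: (pickle c) => h; rewrite {}/c => -[/= hp hS hr hA] [[p0 pb _ _] _ SE rE [_ AE]].
have [bA b1 bz] : [/\ beta \in Aint, 1 < `|beta| & forall z,
    conjugates_over_Q beta z -> z != beta -> z != beta^* -> `|z| <= 1].
  by case: bPS => [[bA b1 bz]|[bA b1 bz _]]; split=> // z z1 z2 z3; rewrite ?ltW ?bz.
have sA : size cA = D.+1 by rewrite -(size_map (zeval^~ beta)) -AE size_mkseq.
have AE' k : (k <= D)%N -> A k = zeval cA`_k beta.
  move=> kD; rewrite -(nth_mkseq 0 A (_ : k < D.+1)%N) // AE (nth_map 0) // sA.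
  by rewrite ltnS.
(* For [D = 0] the relation would read [A 0 = 0], against [A D != 0]. *)
have D0 : (0 < D)%N.
  rewrite lt0n; apply: contra_neq AD => D0.
  by move: rel; rewrite D0 big_ord1 expr0 mulr1.
have DH : (D <= height_of_code h)%N.
  apply: leq_trans (leq_height_of_code h); apply: leq_trans hA.
  by apply: leq_trans (pickle_seq_size cA); rewrite sA leqW.
have rH' : (r <= height_of_code h)%N by rewrite -rE (leq_trans hr) ?leq_height_of_code.
have aH k : (k <= D)%N -> height_le (height_of_code h) cA`_k.
  move=> kD; apply: height_le_pickle; apply: leq_trans hA.
  by apply: pickle_seq_mem; rewrite mem_nth // sA ltnS.
(* Each digit is represented by one of the finitely many polynomials listed in the code, which
   bounds all their heights at once. *)
pose tau (k : nat) := nth 0 cS (index (t (1 - r%:Z + k%:Z)) [seq zeval s beta | s <- cS]).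
have tS' (k : nat) : t (1 - r%:Z + k%:Z) \in [seq zeval s beta | s <- cS].
  by rewrite -SE tS // lerDl.
have ti (k : nat) : (index (t (1 - r%:Z + k%:Z)%R) [seq zeval s beta | s <- cS] < size cS)%N.
  by rewrite -[X in (_ < X)%N](size_map (zeval^~ beta)) index_mem.
have tauH (k : nat) : height_le (height_of_code h) (tau k).
  apply: height_le_pickle; apply: leq_trans hS.
  by apply: pickle_seq_mem; rewrite mem_nth.
have tE (k : nat) : t (1 - r%:Z + k%:Z) = zeval (tau k) beta.
  by rewrite /tau -(@nth_map _ 0 _ 0 (zeval^~ beta) _ _ (ti k)) nth_index.
split; rewrite ?invr_gt0 ?exprn_gt0 ?ltr0n ?expn_gt0 // => N.
rewrite ler_nat => NC.
have N0 : (0 < N)%N by rewrite (leq_trans _ NC) // expn_gt0.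
(* Since [2 ^ l <= N < 2 ^ l.+1], [count_bound] is applied with [l.+1]. *)
pose l := trunc_log 2 N.
have lN : (2 ^ l <= N)%N by rewrite trunc_logP.
have Nl : (N < 2 ^ l.+1)%N by rewrite trunc_log_ltn.
have Ql : (2 * Q h + 1 <= l)%N by rewrite trunc_log_max.
have NB := @count_bound (height_of_code h) D r N l.+1 beta xi pi p (fun k => cA`_k) tau t
  bA b1 bz p0 (height_le_pickle hp) pb DH rH' isT Nl aH tauH tE ex.
have {}NB : (N < gap_factor (height_of_code h) * l.+1 * ((height_of_code h + 2) * (num_changes t N + height_of_code h + 1) ^ D))%N.
  apply: NB pi0 _ _ => [|k kD|n n0].
  - by rewrite -[RHS]rel; apply: eq_bigr => k _; rewrite AE' // -ltnS.
  - by rewrite -AE'; [exact: aP | case/andP: kD].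
  - by rewrite -AE' //; exact: a0.
have [gam0 {}NB] := count_bound_large DH lN (leq_trans (leq_addr 1 _) Ql) NB.
have Q0 : (0 < count_factor (height_of_code h))%N.
  by rewrite lt0n; apply/eqP => q0; rewrite q0 !mul0n in NB.
by apply: powR_count_bound NB => //; rewrite (leq_trans _ Ql) // addn1.
Qed.
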